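(* Let $\mathscr{A}$ be a $C^*$-algebra of compact operators and let $\mathscr{X}$ and $\mathscr{Y}$ be Hilbert $C^*$-modules over $\mathscr{A}$. Suppose that $B:\mathscr{X}\times\mathscr{Y}\to\mathscr{A}$ is a map satisfying: (a) $B$ is a bounded $\mathscr{A}$-sesquilinear form; (b) there exist $c>0$ and $k>0$ such that for any $f\in\mathcal{PS}(\mathscr{A})$ and any $x\in\mathscr{X}$ there exists $y\in\mathscr{Y}$ such that $\|y\|=1$, $f(|y|)\geq k$ and $|f(B(x,y))|\geq c\,f(|x|)\,f(|y|)$; (c) there exist $c>0$ and $k>0$ such that for any $f\in\mathcal{PS}(\mathscr{A})$ and any $y\in\mathscr{Y}$ there exists $x\in\mathscr{X}$ such that $\|x\|=1$, $f(|x|)\geq k$ and $|f(B(x,y))|\geq c\,f(|x|)\,f(|y|)$. Then there exists a bounded adjointable invertible $\mathscr{A}$-linear operator $T:\mathscr{X}\to\mathscr{Y}$ such that $B(x,y)=\langle T(x),y\rangle$ for any $x\in\mathscr{X}$ and any $y\in\mathscr{Y}$.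
   Context: A $C^*$-algebra of compact operators is a $C^*$-algebra admitting a faithful $*$-representation in the set of compact operators on some Hilbert space. Hilbert $C^*$-modules are right modules over the coefficient $C^*$-algebra $\mathscr{A}$, with $\mathscr{A}$-valued inner product $\langle\cdot,\cdot\rangle$ that is $\mathscr{A}$-linear in the second variable and conjugate $\mathscr{A}$-linear in the first. For an element $x$ of such a module, $\|x\|=\|\langle x,x\rangle\|^{1/2}$ and $|x|=\langle x,x\rangle^{1/2}\in\mathscr{A}$ is the positive square root. $\mathcal{PS}(\mathscr{A})$ denotes the set of all pure states of $\mathscr{A}$. An $\mathscr{A}$-sesquilinear form $B:\mathscr{X}\times\mathscr{Y}\to\mathscr{A}$ is a map that is $\mathscr{A}$-linear on $\mathscr{Y}$ and anti-$\mathscr{A}$-linear on $\mathscr{X}$, i.e. linear in the second variable, conjugate-linear in the first, with $B(xa,yb)=a^*B(x,y)b$ for $a,b\in\mathscr{A}$. *)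

(* Defs.v *)
From HB Require Import structures.
From mathcomp Require Import all_boot all_order all_algebra.
From mathcomp Require Import all_classical all_reals all_analysis.
From mathcomp Require Import complex.

Set Implicit Arguments.
Unset Strict Implicit.
Unset Printing Implicit Defensive.

Import Order.TTheory GRing.Theory Num.Theory numFieldNormedType.Exports.

Local Open Scope classical_set_scope.
Local Open Scope ring_scope.
Local Open Scope complex_scope.

(* No unit is assumed, so the product cannot come from MathComp's ring
   hierarchy, whose rings are all unital. *)
HB.mixin Record isCstarAlgebra (R : realType) A
    of CompleteNormedModule R[i] A := {
  cmul : A -> A -> A ;
  star : A -> A ;
  cmulA : associative cmul ;
  cmulDl : left_distributive cmul +%R ;
  cmulDr : right_distributive cmul +%R ;
  cmulZl : forall (k : R[i]) (a b : A), cmul (k *: a) b = k *: cmul a b ;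
  cmulZr : forall (k : R[i]) (a b : A), cmul a (k *: b) = k *: cmul a b ;
  starK : involutive star ;
  starD : {morph star : a b / a + b} ;
  starZ : forall (k : R[i]) (a : A), star (k *: a) = Num.conj k *: star a ;
  starM : forall a b : A, star (cmul a b) = cmul (star b) (star a) ;
  norm_cmul : forall a b : A, `|cmul a b| <= `|a| * `|b| ;
  norm_star_cmul : forall a : A, `|cmul (star a) a| = `|a| ^+ 2
}.

#[short(type="cstarType")]
HB.structure Definition CstarAlgebra (R : realType) :=
  {A of CompleteNormedModule R[i] A & isCstarAlgebra R A}.

Definition cpositive (R : realType) (A : cstarType R) (a : A) : Prop :=
  exists b : A, a = cmul (star b) b.

(* Every positive element has exactly one positive square root, so the default
   value of [get] is never used on positive arguments. *)
Definition csqrt (R : realType) (A : cstarType R) (a : A) : A :=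
  get [set b : A | cpositive b /\ cmul b b = a].

HB.mixin Record isHilbertModule (R : realType) (A : cstarType R) X
    of CompleteNormedModule R[i] X := {
  ract : X -> A -> X ;
  ip : X -> X -> A ;
  ractDl : forall (x y : X) (a : A), ract (x + y) a = ract x a + ract y a ;
  ractDr : forall (x : X) (a b : A), ract x (a + b) = ract x a + ract x b ;
  ractA : forall (x : X) (a b : A), ract (ract x a) b = ract x (cmul a b) ;
  ractZl : forall (k : R[i]) (x : X) (a : A), ract (k *: x) a = k *: ract x a ;
  ractZr : forall (k : R[i]) (x : X) (a : A), ract x (k *: a) = k *: ract x a ;
  ipDr : forall x y z : X, ip x (y + z) = ip x y + ip x z ;
  ipZr : forall (k : R[i]) (x y : X), ip x (k *: y) = k *: ip x y ;
  ip_ract : forall (x y : X) (a : A), ip x (ract y a) = cmul (ip x y) a ;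
  ip_star : forall x y : X, star (ip x y) = ip y x ;
  ip_positive : forall x : X, cpositive (ip x x) ;
  ip_eq0 : forall x : X, ip x x = 0 -> x = 0 ;
  norm_ip : forall x : X, `|x| = sqrtC `|ip x x|
}.

#[short(type="hilbertModType")]
HB.structure Definition HilbertModule (R : realType) (A : cstarType R) :=
  {X of CompleteNormedModule R[i] X & isHilbertModule R A X}.

Arguments ip {R A s}.
Arguments ract {R A s}.

Definition modabs (R : realType) (A : cstarType R) (X : hilbertModType A)
  (x : X) : A := csqrt (ip x x).

Section States.
Context {R : realType} {A : cstarType R}.
Implicit Types f g : {scalar A}.

Definition positive_functional f : Prop := forall a, cpositive a -> 0 <= f a.

Definition state f : Prop :=
  positive_functional f /\
  supremums [set `|f a| | a in [set a : A | `|a| <= 1]] 1.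

(* Purity in the form that makes sense without a unit: every positive
   functional dominated by f is a multiple of f. *)
Definition pure_state f : Prop :=
  state f /\
  forall g, positive_functional g ->
    (forall a, cpositive a -> g a <= f a) ->
    exists2 t : R, 0 <= t <= 1 & forall a, g a = t%:C * f a.

End States.

Section CompactOperators.
Context {R : realType}.

Definition compact_operator (H : completeNormedModType R[i])
    (u : {linear H -> H}) : Prop :=
  precompact (u @` [set x : H | `|x| <= 1]).

(* A Hilbert space is a complete normed space H whose norm comes from a
   positive definite Hermitian form; forms of type {dot _ for _} are linear in
   the first variable. *)
Definition hilbert_form (H : completeNormedModType R[i])
    (form : {dot H for (@Num.conj R[i])}) : Prop :=
  forall x : H, `|x| = sqrtC (form x x).

Definition star_representation (A : cstarType R)
    (H : completeNormedModType R[i]) (form : {dot H for (@Num.conj R[i])})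
    (pi : A -> {linear H -> H}) : Prop :=
  [/\ forall a b x, pi (a + b) x = pi a x + pi b x,
      forall (k : R[i]) a x, pi (k *: a) x = k *: pi a x,
      forall a b x, pi (cmul a b) x = pi a (pi b x) &
      forall a x y, form (pi a x) y = form x (pi (star a) y)].

Definition algebra_of_compact_operators (A : cstarType R) : Prop :=
  exists (H : completeNormedModType R[i])
         (form : {dot H for (@Num.conj R[i])})
         (pi : A -> {linear H -> H}),
    [/\ hilbert_form form,
        star_representation form pi,
        forall a b, pi a =1 pi b -> a = b &
        forall a, compact_operator (pi a)].

End CompactOperators.

Section Operators.
Context {R : realType} {A : cstarType R}.

Definition bounded_sesquilinear (X Y : hilbertModType A) (B : X -> Y -> A)
  : Prop :=
  [/\ bilinear_for (Num.conj \; *:%R) *:%R B,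
      forall x y a b, B (ract x a) (ract y b) = cmul (cmul (star a) (B x y)) b &
      exists M : R, forall x y, `|B x y| <= M%:C * `|x| * `|y|].

Definition bounded_adjointable (X Y : hilbertModType A) (T : {linear X -> Y})
  : Prop :=
  [/\ forall x a, T (ract x a) = ract (T x) a,
      exists M : R, forall x, `|T x| <= M%:C * `|x| &
      exists S : Y -> X, forall x y, ip (T x) y = ip x (S y)].

Definition invertible (X Y : hilbertModType A) (T : {linear X -> Y}) : Prop :=
  exists S : {linear Y -> X},
    [/\ bounded_adjointable S, cancel T S & cancel S T].

End Operators.

(* Main.v *)
From HB Require Import structures.
Require Import Defs.
From mathcomp Require Import all_boot all_order all_algebra.
From mathcomp Require Import all_classical all_reals all_analysis complex.
From mathcomp Require Import ring lra zify.

Set Implicit Arguments.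
Unset Strict Implicit.
Unset Printing Implicit Defensive.

Import Order.TTheory GRing.Theory Num.Theory numFieldNormedType.Exports.

Local Open Scope classical_set_scope.
Local Open Scope ring_scope.
Local Open Scope complex_scope.

(** For a minimal projection [p] of [A] the corner [p A p] is [C p], so that
    [p a p = f a *: p] defines a functional [f], which is a pure state
    ([corner_pure]). The slices [X p] and [Y p] are Hilbert spaces for the
    scalar products [f <x, y>], and on them [B] is a bounded scalar form. As the
    modulus of an [x] in [X p] is [nr x *: p], hypothesis (b) at the state [f]
    says that this scalar form is bounded below in [x], with the constant [c k],
    and (c) says the same in [y].

    Riesz representation on the slices gives the vector [T (x p)] that
    represents [B (x p)], first on [Y p] and then on [Y]. The [x] for which
    [B x] is represented form a closed subspace, and the slices span a dense one
    ([module_density]); this defines [T], and likewise the operator [S] that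
    represents the adjoint form. Every [x] has its norm attained on some slice
    ([norm_attained]), so that [T] and [S] are bounded below everywhere and not
    only on slices. The range of [T] is therefore closed. It contains each slice
    [Y p], where [T S] is coercive ([symmetric_lax_milgram]), hence is [Y].

    It remains to find enough minimal projections, with approximations in the
    norm of [A]. A faithful representation is isometric ([rep_isometric]). This
    is obtained without spectral theory, from the one fact that
    [2 s = g + s^2] is solvable when [g] has norm at most [1] ([sqrt_exists]),
    which supplies [1 - sqrt (1 - g)] in an algebra without unit. Compactness
    then acts twice. The even powers of a self-adjoint [a] of norm [1] converge
    in norm to a nonzero projection [e] with [a^2 e = e]
    ([spectral_projection]). And on the ranges of an infinite sequence of
    orthogonal nonzero projections that commute with [a], there is no common
    positive lower bound for [a] ([no_orthogonal_sequence]): this gives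
    Noetherian induction on projections ([proj_ind]) and the approximation of
    [x] by some [x q] with [q] a projection ([module_proj_approx]).

    For purity of [f], a positive functional below [f] is given on all of [A]
    without any continuity, while positivity controls it on products only;
    every element of [A] is a product ([factorization]). *)

(** * Identities between linear combinations *)

Section LinearNormalForm.
Context {K : comNzRingType} {V : lmodType K}.

Inductive lexp :=
| LAtom of nat
| LZero
| LAdd of lexp & lexp
| LOpp of lexp
| LScale of K & lexp
| LMuln of lexp & nat.

Fixpoint leval (env : seq V) (e : lexp) : V :=
  match e with
  | LAtom i => nth 0 env i
  | LZero => 0
  | LAdd e1 e2 => leval env e1 + leval env e2
  | LOpp e1 => - leval env e1
  | LScale k e1 => k *: leval env e1
  | LMuln e1 n => leval env e1 *+ n
  end.

Fixpoint lcoef (e : lexp) (i : nat) : K :=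
  match e with
  | LAtom j => if Nat.eqb j i then 1 else 0
  | LZero => 0
  | LAdd e1 e2 => lcoef e1 i + lcoef e2 i
  | LOpp e1 => - lcoef e1 i
  | LScale k e1 => k * lcoef e1 i
  | LMuln e1 n => lcoef e1 i *+ n
  end.

Fixpoint lagree (n : nat) (e1 e2 : lexp) : Prop :=
  match n with
  | 0 => True
  | m.+1 => lcoef e1 m = lcoef e2 m /\ lagree m e1 e2
  end.

Lemma leval_sum env e :
  leval env e = \sum_(i < size env) lcoef e i *: nth 0 env i.
Proof.
elim: e => [j||e1 IH1 e2 IH2|e IH|k e IH|e IH n] /=.
- have [lt_j|ge_j] := ltnP j (size env).
    rewrite (bigD1 (Ordinal lt_j)) //= PeanoNat.Nat.eqb_refl scale1r.
    rewrite big1 ?addr0 // => i ne.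
    case: PeanoNat.Nat.eqb_spec => [E|_]; last by rewrite scale0r.
    by case/eqP: ne; apply: val_inj.
  rewrite nth_default // big1 // => i _.
  case: PeanoNat.Nat.eqb_spec => [E|_]; last by rewrite scale0r.
  by move: (ltn_ord i); rewrite -E ltnNge ge_j.
- by rewrite big1 // => i _; rewrite scale0r.
- by rewrite IH1 IH2 -big_split; apply: eq_bigr => i _; rewrite scalerDl.
- by rewrite IH -sumrN; apply: eq_bigr => i _; rewrite scaleNr.
- by rewrite IH scaler_sumr; apply: eq_bigr => i _; rewrite scalerA.
- by rewrite IH -sumrMnl; apply: eq_bigr => i _; rewrite -scalerMnl.
Qed.

Lemma lagreeP env e1 e2 :
  lagree (size env) e1 e2 -> leval env e1 = leval env e2.
Proof.
move=> h; rewrite !leval_sum; apply: eq_bigr => i _; congr (_ *: _).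
case: i => i /= lt_i; elim: (size env) lt_i h => // n IH.
by rewrite ltnS leq_eqVlt => /predU1P[-> [] //|lt_i [_ /IH]]; apply.
Qed.

End LinearNormalForm.

Ltac lmod_mem x env :=
  lazymatch env with
  | nil => constr:(false)
  | x :: _ => constr:(true)
  | _ :: ?env' => lmod_mem x env'
  end.

Ltac lmod_atoms e env :=
  lazymatch e with
  | (?a + ?b)%R => let env' := lmod_atoms a env in lmod_atoms b env'
  | (- ?a)%R => lmod_atoms a env
  | (?k *: ?a)%R => lmod_atoms a env
  | (?a *+ _)%R => lmod_atoms a env
  | 0%R => env
  | _ => lazymatch lmod_mem e env with
         | true => env
         | false => constr:(e :: env)
         end
  end.

Ltac lmod_index x env :=
  lazymatch env with
  | x :: _ => constr:(0%N)
  | _ :: ?env' => let i := lmod_index x env' in constr:(S i)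
  end.

Ltac lmod_reify K e env :=
  lazymatch e with
  | (?a + ?b)%R => let a' := lmod_reify K a env in
                   let b' := lmod_reify K b env in constr:(@LAdd K a' b')
  | (- ?a)%R => let a' := lmod_reify K a env in constr:(@LOpp K a')
  | (?k *: ?a)%R => let a' := lmod_reify K a env in constr:(@LScale K k a')
  | (?a *+ ?n)%R => let a' := lmod_reify K a env in
                    constr:(@LMuln K a' n)
  | 0%R => constr:(@LZero K)
  | _ => let i := lmod_index e env in constr:(@LAtom K i)
  end.

(** Once the products of a non-unital algebra are expanded they can serve as
    atoms, and an identity is checked coefficient by coefficient in [K]. *)
Ltac lmod_over K :=
  lazymatch goal with
  | |- @eq ?T ?a ?b =>
    let env := lmod_atoms a (@nil T) in
    let env := lmod_atoms b env in
    let a' := lmod_reify K a env in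
    let b' := lmod_reify K b env in
    change (leval env a' = leval env b')
  end;
  apply: lagreeP; cbn [lagree lcoef size Nat.eqb];
  repeat (split; [first [ring | by field]|]); exact: I.

(** * Norms as real numbers, and convergence *)

Section RealNorm.
Context {R : realType}.
Implicit Types V : normedModType R[i].

Definition nr {V : normedZmodType R[i]} (x : V) : R := complex.Re `|x|.

Lemma nrE (V : normedZmodType R[i]) (x : V) : `|x| = (nr x)%:C.
Proof. by rewrite RRe_real ?normr_real. Qed.

Lemma nr_ge0 (V : normedZmodType R[i]) (x : V) : 0 <= nr x.
Proof. by rewrite -ler0c -nrE. Qed.

Lemma nr0 (V : normedZmodType R[i]) : nr (0 : V) = 0.
Proof. by apply: complexI; rewrite -nrE normr0. Qed.

Lemma nr_eq0 (V : normedZmodType R[i]) (x : V) : nr x = 0 -> x = 0.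
Proof. by move=> h; apply/eqP; rewrite -normr_eq0 nrE h. Qed.

Lemma nr_gt0 (V : normedZmodType R[i]) (x : V) : x <> 0 -> 0 < nr x.
Proof.
by move=> h; rewrite lt0r nr_ge0 andbT; apply/eqP => /nr_eq0.
Qed.

Lemma nrD (V : normedZmodType R[i]) (x y : V) : nr (x + y) <= nr x + nr y.
Proof. by rewrite -lecR rmorphD /= -!nrE ler_normD. Qed.

Lemma nrN (V : normedZmodType R[i]) (x : V) : nr (- x) = nr x.
Proof. by apply: complexI; rewrite -!nrE normrN. Qed.

Lemma nrBC (V : normedZmodType R[i]) (x y : V) : nr (x - y) = nr (y - x).
Proof. by rewrite -nrN opprB. Qed.

Lemma nrB (V : normedZmodType R[i]) (x y : V) : nr (x - y) <= nr x + nr y.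
Proof. by rewrite -(nrN y) nrD. Qed.

Lemma nr_sub_trans (V : normedZmodType R[i]) (y x z : V) :
  nr (x - z) <= nr (x - y) + nr (y - z).
Proof. by rewrite (le_trans _ (nrD _ _)) // addrA subrK. Qed.

Lemma nrZ V (k : R[i]) (x : V) : nr (k *: x) = nr k * nr x.
Proof. by apply: complexI; rewrite rmorphM /= -!nrE normrZ. Qed.

Lemma nr_real (r : R) : nr r%:C = `|r|.
Proof.
apply: complexI; rewrite -nrE normc_def /= expr0n /= addr0 sqrtr_sqr //.
Qed.

Lemma nr_nat (n : nat) : nr (n%:R : R[i]) = n%:R.
Proof. by rewrite -(rmorph_nat (real_complex R)) nr_real ger0_norm. Qed.

Lemma nrV (a : R[i]) : nr a^-1 = (nr a)^-1.
Proof. by apply: complexI; rewrite fmorphV /= -!nrE normfV. Qed.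

Lemma nr_i : nr ('i : R[i]) = 1.
Proof. by apply: complexI; rewrite -nrE normCi. Qed.

Lemma conj_real (r : R) : Num.conj r%:C = r%:C.
Proof. exact: conjc_real. Qed.

Lemma geo_small (r e : R) : 0 <= r < 1 -> 0 < e ->
  exists N, forall n, (N <= n)%N -> r ^+ n < e.
Proof.
move=> /andP[r0 r1] e0; have h : `|r| < 1 by rewrite ger0_norm.
have /cvgrPdist_lt /(_ e e0) [N _ hN] := cvg_expr h.
exists N => n /hN /=; rewrite sub0r normrN ger0_norm ?exprn_ge0 //.
Qed.

(** Convergence in norm, with the norm read in [R]: order arguments over
    [R[i]] are thereby replaced by linear arithmetic over [R]. *)
Definition tends {V} (u : nat -> V) (l : V) :=
  forall e : R, 0 < e -> exists N, forall n, (N <= n)%N -> nr (u n - l) < e.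

Lemma nr_complete (V : completeNormedModType R[i]) (u : nat -> V) :
  (forall e : R, 0 < e -> exists N, forall n m, (N <= n)%N -> (N <= m)%N ->
     nr (u n - u m) < e) ->
  exists l, tends u l.
Proof.
move=> hC.
have /cauchy_cvg : cauchy (u @ \oo).
  apply/cauchyP => e e0.
  have er : e = (complex.Re e)%:C by rewrite RRe_real // gtr0_real.
  have e0' : 0 < complex.Re e by rewrite -ltcR -er.
  have [N hN] := hC _ e0'; exists (u N); exists N => // n /= hn.
  rewrite -ball_normE /= nrE er ltcR; apply: hN => //.
move=> /cvgrPdist_lt h; exists (lim (u @ \oo)) => e e0.
have e0' : 0 < e%:C by rewrite -(rmorph0 (real_complex R)) ltcR.
have [N _ hN] := h _ e0'; exists N => n /hN /=.
by rewrite nrE ltcR nrBC.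
Qed.

Lemma tends_unique V (u : nat -> V) a b : tends u a -> tends u b -> a = b.
Proof.
move=> ha hb; apply/eqP; rewrite -subr_eq0; apply/eqP; apply: nr_eq0.
apply/eqP; rewrite eq_le nr_ge0 andbT leNgt; apply/negP => h.
have [N hN] := ha (nr (a - b) / 2) ltac:(lra).
have [M hM] := hb (nr (a - b) / 2) ltac:(lra).
have := hN (maxn N M) (leq_maxl _ _); have := hM (maxn N M) (leq_maxr _ _).
have := nr_sub_trans (u (maxn N M)) a b; rewrite (nrBC a (u _)); lra.
Qed.

Lemma tends_cst V (a : V) : tends (fun=> a) a.
Proof. by move=> e e0; exists 0%N => n _; rewrite subrr nr0. Qed.

Lemma tends_ext V (u v : nat -> V) l : u =1 v -> tends u l -> tends v l.
Proof.
by move=> E h e e0; have [N hN] := h e e0; exists N => n /hN; rewrite E.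
Qed.

Lemma tends_sub V (u : nat -> V) l (f : nat -> nat) :
  (forall n, (n <= f n)%N) -> tends u l -> tends (fun n => u (f n)) l.
Proof.
by move=> hf h e e0; have [N hN] := h e e0; exists N => n hn;
  apply: hN; apply: leq_trans (hf n).
Qed.

Lemma tends_shift V (u : nat -> V) l k :
  tends u l -> tends (fun n => u (k + n)%N) l.
Proof.
move=> h e e0; have [N hN] := h e e0; exists N => n hn.
by apply: hN; rewrite (leq_trans hn) // leq_addl.
Qed.

Lemma tendsD V (u v : nat -> V) a b :
  tends u a -> tends v b -> tends (fun n => u n + v n) (a + b).
Proof.
move=> ha hb e e0; have [N hN] := ha (e / 2) ltac:(lra).
have [M hM] := hb (e / 2) ltac:(lra); exists (maxn N M) => n.
rewrite geq_max => /andP[/hN h1 /hM h2].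
have -> : u n + v n - (a + b) = (u n - a) + (v n - b) by lmod_over (R[i]).
by have := nrD (u n - a) (v n - b); lra.
Qed.

Lemma tends_lip V (W : normedModType R[i]) (f : V -> W) (K : R) u l :
  (forall x y, nr (f x - f y) <= K * nr (x - y)) ->
  tends u l -> tends (fun n => f (u n)) (f l).
Proof.
move=> hf h e e0; have K1 : 0 < `|K| + 1 by have := normr_ge0 K; lra.
have [N hN] := h (e / (`|K| + 1)) (divr_gt0 e0 K1); exists N => n /hN.
rewrite ltr_pdivlMr // => h1; have := hf (u n) l; have := nr_ge0 (u n - l).
have := ler_norm K; nra.
Qed.

Lemma tends_le V (u : nat -> V) l z c N :
  tends u l -> (forall n, (N <= n)%N -> nr (u n - z) <= c) -> nr (l - z) <= c.
Proof.
move=> h hc; rewrite leNgt; apply/negP => hlt.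
have [M hM] := h (nr (l - z) - c) ltac:(lra).
have := hM (maxn N M) (leq_maxr _ _); have := hc (maxn N M) (leq_maxl _ _).
have := nr_sub_trans (u (maxn N M)) l z; rewrite (nrBC l (u _)); lra.
Qed.

Lemma tends_squeeze V (u : nat -> V) l (r c : R) :
  0 <= r < 1 -> (forall n, nr (u n - l) <= c * r ^+ n) -> tends u l.
Proof.
move=> hr h e e0; have c1 : 0 < `|c| + 1 by have := normr_ge0 c; lra.
have [N hN] := geo_small hr (divr_gt0 e0 c1); exists N => n /hN.
rewrite ltr_pdivlMr // => h1; have := h n; have := ler_norm c.
have : 0 <= r ^+ n by rewrite exprn_ge0 //; case/andP: hr.
nra.
Qed.

Lemma nr_complete_geometric (V : completeNormedModType R[i]) (u : nat -> V)
  (C : R) : (forall n, nr (u n.+1 - u n) <= C * 2^-1 ^+ n) -> exists l, tends u l.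
Proof.
move=> hu.
have hk n k : nr (u (n + k)%N - u n) <= 2 * C * (2^-1 ^+ n - 2^-1 ^+ (n + k)).
  elim: k => [|k IH]; first by rewrite addn0 !subrr nr0 mulr0.
  have := nr_sub_trans (u (n + k)%N) (u (n + k).+1) (u n); have := hu (n + k)%N.
  rewrite addnS exprS; lra.
have C0 : 0 <= C.
  by have := hu 0%N; rewrite expr0 mulr1; apply: le_trans (nr_ge0 _).
apply: nr_complete => d d0.
have r01 : 0 <= (2^-1 : R) < 1 by apply/andP; split; lra.
have e0 : 0 < d / (4 * C + 1) by apply: divr_gt0; lra.
have [N hN] := geo_small r01 e0; exists N => n m hn hm.
have := hN N (leqnn N); rewrite ltr_pdivlMr; last by lra.
have := hk N (n - N)%N; have := hk N (m - N)%N; rewrite !subnKC //.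
have := nr_sub_trans (u N) (u n) (u m); rewrite (nrBC (u N) (u m)).
have pos k : 0 <= (2^-1 : R) ^+ k by rewrite exprn_ge0 // invr_ge0.
have := pos n; have := pos m; have := pos N; nra.
Qed.

End RealNorm.

(** * Square roots in a non-unital algebra *)

Section CstarBasics.
Context {R : realType} {A : cstarType R}.
Implicit Types a b c g s : A.

Lemma cmulNl a b : cmul (- a) b = - cmul a b.
Proof. by rewrite -scaleN1r cmulZl scaleN1r. Qed.

Lemma cmulNr a b : cmul a (- b) = - cmul a b.
Proof. by rewrite -scaleN1r cmulZr scaleN1r. Qed.

Lemma cmul0l a : cmul 0 a = 0.
Proof. by have := cmulZl 0 (0 : A) a; rewrite !scale0r. Qed.

Lemma cmul0r a : cmul a 0 = 0.
Proof. by have := cmulZr 0 a (0 : A); rewrite !scale0r. Qed.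

Lemma star0 : star (0 : A) = 0.
Proof. by have := starZ 0 (0 : A); rewrite rmorph0 !scale0r. Qed.

Lemma starN a : star (- a) = - star a.
Proof. by rewrite -scaleN1r starZ rmorphN rmorph1 scaleN1r. Qed.

Lemma cmulMnl a b n : cmul (a *+ n) b = cmul a b *+ n.
Proof. by elim: n => [|n IH]; rewrite ?cmul0l // !mulrS cmulDl IH. Qed.

Lemma cmulMnr a b n : cmul a (b *+ n) = cmul a b *+ n.
Proof. by elim: n => [|n IH]; rewrite ?cmul0r // !mulrS cmulDr IH. Qed.

Lemma starMn a n : star (a *+ n) = star a *+ n.
Proof. by elim: n => [|n IH]; rewrite ?star0 // !mulrS starD IH. Qed.

Definition calgE := (@cmulDl R A, @cmulDr R A, cmulNl, cmulNr, @cmulZl R A,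
  @cmulZr R A, cmul0l, cmul0r, cmulMnl, cmulMnr, @starM R A, @starD R A, starN,
  @starZ R A, star0, starMn, @starK R A, @cmulA R A).

Lemma nr_cmul a b : nr (cmul a b) <= nr a * nr b.
Proof. by rewrite -lecR rmorphM /= -!nrE norm_cmul. Qed.

Lemma nr_star_cmul a : nr (cmul (star a) a) = nr a ^+ 2.
Proof. by apply: complexI; rewrite -nrE norm_star_cmul nrE rmorphXn. Qed.

Lemma nr_star a : nr (star a) = nr a.
Proof.
have le b : nr b <= nr (star b).
  have [->|/eqP/nr_gt0 h] := eqVneq b 0; first by rewrite star0.
  by have := nr_cmul (star b) b; rewrite nr_star_cmul expr2 ler_pM2r.
by apply/eqP; rewrite eq_le le -{2}(starK a) le.
Qed.

Lemma nr_sqr_sa a : star a = a -> nr (cmul a a) = nr a ^+ 2.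
Proof. by move=> {1}<-; rewrite nr_star_cmul. Qed.

Lemma tends_cmul (u v : nat -> A) a b :
  tends u a -> tends v b -> tends (fun n => cmul (u n) (v n)) (cmul a b).
Proof.
move=> ha hb e e0.
have k1 : 0 < nr a + nr b + 1 by have := nr_ge0 a; have := nr_ge0 b; lra.
have d0 : 0 < Num.min 1 (e / (nr a + nr b + 1)).
  by rewrite lt_min ltr01 divr_gt0.
have [N hN] := ha _ d0; have [M hM] := hb _ d0.
exists (maxn N M) => n; rewrite geq_max => /andP[/hN h1 /hM h2].
set d := Num.min _ _ in d0 h1 h2.
have d1 : d <= 1 by rewrite ge_min lexx.
have d2 : d * (nr a + nr b + 1) <= e.
  by rewrite -ler_pdivlMr // ge_min lexx orbT.
have -> : cmul (u n) (v n) - cmul a b =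
    cmul (u n - a) (v n - b) + (cmul (u n - a) b + cmul a (v n - b)).
  by rewrite !calgE; lmod_over (R[i]).
have := nrD (cmul (u n - a) (v n - b)) (cmul (u n - a) b + cmul a (v n - b)).
have := nrD (cmul (u n - a) b) (cmul a (v n - b)).
have := nr_cmul (u n - a) (v n - b); have := nr_cmul (u n - a) b.
have := nr_cmul a (v n - b).
have := nr_ge0 a; have := nr_ge0 b; have := nr_ge0 (u n - a).
have := nr_ge0 (v n - b); move: h1 h2 d1 d2.
move: (nr (u n - a)) (nr (v n - b)) (nr a) (nr b) => x y p q hx hy d1 d2.
move=> y0 x0 q0 p0 h1 h2 h3 h4 h5.
have : x * y < d * 1.
  have : x * y <= x * d by rewrite ler_wpM2l // ltW.
  by have : x * d <= x * 1 by [rewrite ler_wpM2l]; lra.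
have : x * q <= d * q by rewrite ler_wpM2r // ltW.
have : p * y <= p * d by rewrite ler_wpM2l // ltW.
lra.
Qed.

Lemma tends_star (u : nat -> A) a :
  tends u a -> tends (fun n => star (u n)) (star a).
Proof.
apply: (@tends_lip _ _ _ _ 1) => x y.
by rewrite mul1r -(nr_star (x - y)) starD starN.
Qed.

(** Picard iteration for [s = (g + s^2) / 2]. *)
Fixpoint sqrt_iter g n : A :=
  if n is m.+1 then 2^-1 *: (g + cmul (sqrt_iter g m) (sqrt_iter g m)) else 0.

(** The same iteration for the number [g = 1], which increases to [1]. *)
Fixpoint sqrt_major n : R :=
  if n is m.+1 then (1 + sqrt_major m ^+ 2) / 2 else 0.

Lemma sqrt_major_bounds n :
  0 <= sqrt_major n <= 1 /\ sqrt_major n <= sqrt_major n.+1.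
Proof.
elim: n => [|n [/andP[h1 h2] h3]] /=; first by split; nra.
split; first by apply/andP; split; nra.
by move: h3 => /=; nra.
Qed.

Lemma sqrt_major_cauchy (e : R) : 0 < e -> exists N, forall n, (N <= n)%N ->
  sqrt_major n - sqrt_major N < e.
Proof.
move=> e0.
have mono : nondecreasing_seq sqrt_major.
  by apply/nondecreasing_seqP => n; case: (sqrt_major_bounds n).
have /cvg_ex[l /= hl] : cvgn sqrt_major.
  apply: nondecreasing_is_cvgn => //; exists 1 => _ [n _ <-].
  by case: (sqrt_major_bounds n) => /andP[].
move: hl => /cvgrPdist_lt /(_ (e / 2) ltac:(lra)) [N _ hN]; exists N => n hn.
have := hN n hn; have := hN N (leqnn N); rewrite /= !ltr_norml; lra.
Qed.

Lemma sqrt_iter_major g n : nr g <= 1 ->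
  nr (sqrt_iter g n) <= sqrt_major n /\
  nr (sqrt_iter g n.+1 - sqrt_iter g n) <= sqrt_major n.+1 - sqrt_major n.
Proof.
have half : nr (2^-1 : R[i]) = 2^-1 by rewrite nrV nr_nat.
move=> g1; elim: n => [|n [h1 h2]].
  rewrite /= cmul0l !addr0 !subr0 nr0 nrZ half; split=> //.
  by rewrite expr0n /= addr0 mulrC ler_pM2r // invr_gt0.
set s := sqrt_iter g n in h1 h2; set t := sqrt_iter g n.+1 in h2 *.
have [/andP[m0 m1] m2] := sqrt_major_bounds n.
have ht : nr t <= sqrt_major n.+1.
  rewrite /t /= nrZ half -/s mulrC ler_pM2r ?invr_gt0 //.
  have := nrD g (cmul s s); have := nr_cmul s s; have := nr_ge0 s; nra.
split=> //.
have -> : sqrt_iter g n.+2 - t = 2^-1 *: (cmul t (t - s) + cmul (t - s) s).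
  have -> : sqrt_iter g n.+2 - t =
      2^-1 *: (g + cmul t t) - 2^-1 *: (g + cmul s s) by [].
  by rewrite !calgE; lmod_over (R[i]).
rewrite nrZ half mulrC /=.
have := nrD (cmul t (t - s)) (cmul (t - s) s).
have := nr_cmul t (t - s); have := nr_cmul (t - s) s.
move: h2 ht => /=; have := nr_ge0 s; have := nr_ge0 t; have := nr_ge0 (t - s).
move: (nr t) (nr s) (nr (t - s)) h1 m0 m1 m2 => /= x y z.
set m := sqrt_major n; set m' := (1 + m ^+ 2) / 2 => h1 m0 m1 m2 z0 x0 y0 hz hx.
move=> h3 h4 h5.
have : x * z <= m' * (m' - m) by apply: ler_pM.
have : z * y <= (m' - m) * m by apply: ler_pM.
have : m' * 2 = 1 + m ^+ 2 by rewrite /m' divfK.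
by clearbody m'; nra.
Qed.

(** The solution [s] of [2 s = g + s^2] is [1 - sqrt (1 - g)], which lies in the
    algebra although [1] need not. The iterates are dominated term by term by
    those for the number [1], so that they converge even when [g] has norm
    [1]. *)
Lemma sqrt_exists g : nr g <= 1 -> exists s,
  [/\ s *+ 2 = g + cmul s s, nr s <= 1, (star g = g -> star s = s) &
      forall c, cmul c g = cmul g c -> cmul c s = cmul s c].
Proof.
move=> g1.
have mono n k : nr (sqrt_iter g (n + k) - sqrt_iter g n) <=
    sqrt_major (n + k) - sqrt_major n.
  elim: k => [|k IH]; first by rewrite addn0 !subrr nr0.
  rewrite addnS; have [_] := sqrt_iter_major (n + k) g1.
  have := nr_sub_trans (sqrt_iter g (n + k)) (sqrt_iter g (n + k).+1)
    (sqrt_iter g n); lra.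
have [s hs] : exists s, tends (sqrt_iter g) s.
  apply: nr_complete => e e0.
  have [N hN] := sqrt_major_cauchy (e := e / 2) ltac:(lra).
  exists N => n m hn hm.
  have := mono N (n - N)%N; have := mono N (m - N)%N; rewrite !subnKC //.
  have := hN n hn; have := hN m hm.
  have := nr_sub_trans (sqrt_iter g N) (sqrt_iter g n) (sqrt_iter g m).
  by rewrite (nrBC (sqrt_iter g N)); lra.
have hlim (f f' : A -> A) K K' :
    (forall x y, nr (f x - f y) <= K * nr (x - y)) ->
    (forall x y, nr (f' x - f' y) <= K' * nr (x - y)) ->
    (forall n, f (sqrt_iter g n) = f' (sqrt_iter g n)) -> f s = f' s.
  move=> hf hf' E; apply: (tends_unique (tends_lip hf hs)).
  have -> : (fun n => f (sqrt_iter g n)) = (fun n => f' (sqrt_iter g n)).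
    by apply/funext.
  exact: (tends_lip hf' hs).
exists s; split.
- have h := tendsD (tends_cst g) (tends_cmul hs hs).
  apply: (tends_unique _ h).
  have := tends_shift 1 hs; rewrite /= => h2.
  apply: (eq_rect _ (fun u => tends u _) (tendsD h2 h2)).
  by apply/funext => n; rewrite add0n; lmod_over (R[i]).
- have := tends_le (z := 0) (c := 1) (N := 0%N) hs; rewrite subr0; apply=> n _.
  rewrite subr0; have [h _] := sqrt_iter_major n g1.
  by have [/andP[_ h']] := sqrt_major_bounds n; lra.
- move=> gs; apply: (hlim star id 1 1) => [x y|x y|n].
  + by rewrite mul1r -(nr_star (x - y)) !calgE.
  + by rewrite mul1r.
  + elim: n => [|n IH] /=; first by rewrite star0.
    by rewrite starZ starD starM gs IH fmorphV /= rmorph_nat.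
- move=> c cg; apply: (hlim (cmul c) (cmul^~ c) (nr c) (nr c)) => [x y|x y|n].
  + by have := nr_cmul c (x - y); rewrite !calgE.
  + by have := nr_cmul (x - y) c; rewrite !calgE mulrC.
  + elim: n => [|n IH] /=; first by rewrite !calgE.
    by rewrite cmulZr cmulZl cmulDr cmulDl cg cmulA IH -!cmulA IH.
Qed.

End CstarBasics.

Ltac calg R := rewrite ?calgE; lmod_over (R[i]).

(** * Unitary multipliers *)

Lemma imaginary_unit (R : realType) :
  exists i : R[i], [/\ Num.conj i = - i, i * i = -1 & nr i = 1].
Proof. by exists 'i%R; rewrite conjCi -expr2 sqrCi nr_i. Qed.

Section Unitary.
Context {R : realType} {A : cstarType R}.
Implicit Types a b c d v x : A.

(** With [c] and [v] commuting, self-adjoint and [(1 - c)^2 + v^2 = 1], the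
    multipliers [(c - 1) + i v] and [(c - 1) - i v] are unitary, and [v] is half
    the norm of their difference. *)
Lemma unitary_part_le1 c v : star c = c -> star v = v ->
  cmul c v = cmul v c -> cmul v v = c *+ 2 - cmul c c -> nr v <= 1.
Proof.
move=> cs vs cv vv.
pose u (k : R[i]) x := cmul c x - x + k *: cmul v x.
have ux k x : Num.conj k = - k -> k * k = -1 -> nr (u k x) = nr x.
  move=> kc kk.
  have E : cmul (star (u k x)) (u k x) = cmul (star x) x.
    have E1 : cmul (cmul (star x) v) (cmul v x) =
        cmul (cmul (star x) c) x *+ 2 - cmul (cmul (star x) c) (cmul c x).
      by rewrite cmulA -(cmulA _ v v) vv; calg R.
    have E2 : cmul (cmul (star x) c) (cmul v x) =
        cmul (cmul (star x) v) (cmul c x).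
      by rewrite !cmulA -(cmulA _ c v) cv cmulA.
    have -> : cmul (star (u k x)) (u k x) =
        cmul (cmul (star x) c - star x) (cmul c x - x)
        + (- (k * k)) *: cmul (cmul (star x) v) (cmul v x)
        + k *: (cmul (cmul (star x) c) (cmul v x)
                - cmul (cmul (star x) v) (cmul c x)).
      by rewrite /u starD starZ !starM starD starN starM kc cs vs; calg R.
    by rewrite kk opprK scale1r E2 subrr scaler0 addr0 E1; calg R.
  by apply/eqP; rewrite -(eqrXn2 (n := 2)) ?nr_ge0 // -!nr_star_cmul E.
have hx x : nr (cmul v x) <= nr x.
  have [i [ic ii i1]] := imaginary_unit R.
  have h1 := ux i x ic ii.
  have h2 : nr (u (- i) x) = nr x.
    by apply: ux; [rewrite rmorphN /= ic|rewrite mulrNN].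
  have : nr (u i x - u (- i) x) = 2 * nr (cmul v x).
    have -> : u i x - u (- i) x = i *: (2 *: cmul v x).
      by rewrite /u; lmod_over (R[i]).
    by rewrite !nrZ i1 mul1r nr_nat.
  have := nrB (u i x) (u (- i) x); lra.
have := hx v; rewrite nr_sqr_sa // expr2; have := nr_ge0 v; nra.
Qed.

(** For [d = sin t] this is [|sin (2 t)| <= 1], the square root of [1 - d^2]
    being taken among the multipliers of the algebra. *)
Lemma double_angle_le1 d : star d = d -> nr d <= 1 ->
  nr (cmul d d *+ 4 - cmul (cmul d d) (cmul d d) *+ 4) <= 1.
Proof.
move=> ds d1.
have dd1 : nr (cmul d d) <= 1 by rewrite nr_sqr_sa // expr_le1 // nr_ge0.
have [r [r2 _ rs rc]] := sqrt_exists dd1.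
have dr : cmul d r = cmul r d by apply: rc; rewrite cmulA.
have {}rs : star r = r by apply: rs; rewrite starM ds.
pose c := cmul d d *+ 2; pose v := (d - cmul d r) *+ 2.
have vv : cmul v v = c *+ 2 - cmul c c.
  have -> : cmul v v = cmul (cmul d d) (cmul r r - r *+ 2) *+ 4
                       + cmul d d *+ 4.
    rewrite /v; have E x : cmul (cmul x r) d = cmul (cmul x d) r.
      by rewrite -!cmulA dr.
    by rewrite !calgE !E; lmod_over (R[i]).
  by rewrite r2 /c; calg R.
have vs : star v = v by rewrite /v starMn starD starN starM ds rs dr.
have v1 : nr v <= 1.
  apply: (@unitary_part_le1 c) => //; first by rewrite /c starMn starM ds.
  rewrite /c /v !calgE.
  have -> : cmul (cmul d r) d = cmul (cmul d d) r by rewrite -!cmulA dr.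
  by rewrite -[cmul (cmul (cmul d d) r) d]cmulA -dr; calg R.
have -> : cmul d d *+ 4 - cmul (cmul d d) (cmul d d) *+ 4 = cmul v v.
  by rewrite vv /c; calg R.
by rewrite nr_sqr_sa // expr_le1 // nr_ge0.
Qed.

End Unitary.

(** * Faithful representations are isometric *)

Section Representation.
Context {R : realType} {A : cstarType R} {H : completeNormedModType R[i]}.
Context {form : {dot H for (@Num.conj R[i])}} {rep : A -> {linear H -> H}}.
Context (form_norm : hilbert_form form).
Context (rep_morph : star_representation form rep).
Implicit Types (a b : A) (h k : H).

Lemma formZr z h k : form h (z *: k) = Num.conj z * form h k.
Proof. exact: linearZr_LR. Qed.

Lemma formNr h k : form h (- k) = - form h k.
Proof. by rewrite -scaleN1r formZr rmorphN rmorph1 mulN1r. Qed.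

Lemma formC h k : form h k = Num.conj (form k h).
Proof. by have := hermC form h k; rewrite expr0 mul1r. Qed.

Lemma form_sqr h : form h h = (nr h ^+ 2)%:C.
Proof. by rewrite rmorphXn /= -nrE form_norm sqrtCK. Qed.

Lemma nr_sub_sqr h k :
  nr (h - k) ^+ 2 = nr h ^+ 2 + nr k ^+ 2 - complex.Re (form h k) *+ 2.
Proof.
have := congr1 (@complex.Re R) (form_sqr (h - k)).
rewrite linearBl !linearBr /= !form_sqr (formC k h) => <- /=.
by case: (form h k) => x y /=; ring.
Qed.

Lemma repD a b h : rep (a + b) h = rep a h + rep b h.
Proof. by case: rep_morph. Qed.

Lemma repZ z a h : rep (z *: a) h = z *: rep a h.
Proof. by case: rep_morph. Qed.

Lemma repM a b h : rep (cmul a b) h = rep a (rep b h).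
Proof. by case: rep_morph. Qed.

Lemma rep_adj a h k : form (rep a h) k = form h (rep (star a) k).
Proof. by case: rep_morph. Qed.

Lemma rep0 h : rep 0 h = 0.
Proof. by have := repZ 0 0 h; rewrite !scale0r. Qed.

Lemma repN a h : rep (- a) h = - rep a h.
Proof. by rewrite -scaleN1r repZ scaleN1r. Qed.

Lemma repMn a n h : rep (a *+ n) h = rep a h *+ n.
Proof. by elim: n => [|n IH]; rewrite ?rep0 // !mulrS repD IH. Qed.

Lemma form_rep_sqr a h : form h (rep (cmul (star a) a) h) = (nr (rep a h) ^+ 2)%:C.
Proof. by rewrite repM -rep_adj form_sqr. Qed.

(** If [s] is the solution of [2 s = a^* a + s^2], then
    [|h|^2 - |rep a h|^2 = |h - rep s h|^2]. *)
Lemma rep_contractive a h : nr (rep a h) <= nr a * nr h.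
Proof.
have main b : nr b <= 1 -> nr (rep b h) <= nr h.
  move=> b1.
  have bb1 : nr (cmul (star b) b) <= 1.
    by rewrite nr_star_cmul expr_le1 // nr_ge0.
  have [s [s2 _ ss _]] := sqrt_exists bb1.
  have {}ss : star s = s by apply: ss; rewrite starM starK.
  have E := form_rep_sqr s h; rewrite ss in E.
  have : form h (rep (s *+ 2) h) = (nr (rep b h) ^+ 2)%:C + (nr (rep s h) ^+ 2)%:C.
    by rewrite s2 repD linearDr /= form_rep_sqr E.
  rewrite repMn linearMnr /= => /(congr1 (@complex.Re R)) /=.
  rewrite -ler_sqr ?nnegrE ?nr_ge0 // => E2.
  have := nr_sub_sqr h (rep s h); have := sqr_ge0 (nr (h - rep s h)).
  move: E2; rewrite raddfMn /=; lra.
have [->|/eqP/nr_gt0 a0] := eqVneq a 0; first by rewrite rep0 !nr0 mul0r.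
have := main ((nr a)^-1%:C *: a); rewrite repZ !nrZ nr_real.
rewrite ger0_norm ?invr_ge0 ?nr_ge0 // mulVf ?lt0r_neq0 // => /(_ (lexx _)).
by rewrite ler_pdivrMl.
Qed.

Context (rep_inj : forall a b, rep a =1 rep b -> a = b).

(** Let [s = 1 - sqrt ((1 - 2 a)^2)] with [a = d^2]. As the image of [a] has norm
    at most [1/4], that of [1 - 2 a] is positive; so [s] and [2 a] have the same
    image, and are equal. But [s] has norm at most [1]. *)
Lemma rep_small_le_half d : star d = d -> nr d <= 1 ->
  (forall h, nr (rep (cmul d d) h) <= 4^-1 * nr h) -> nr (cmul d d) <= 2^-1.
Proof.
move=> ds d1; set a := cmul d d => hs.
have [s [s2 s1 _ sc]] := sqrt_exists (double_angle_le1 ds d1).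
rewrite -/a in s2 sc.
have {sc} sa : cmul a s = cmul s a by apply: sc; calg R.
clearbody a; pose w := s - a *+ 2.
(* Both sides of [(2 - s - 2 a) (s - 2 a) = 0], without the unit. *)
have w2 : w *+ 2 = cmul (s + a *+ 2) w.
  rewrite /w mulrnBl s2 !calgE sa; lmod_over (R[i]).
have w0 : w = 0.
  apply: rep_inj => h; rewrite rep0; apply: nr_eq0.
  have := congr1 (fun x => nr (rep x h)) w2.
  rewrite /= repMn repM repD repMn -scaler_nat nrZ nr_nat.
  have := rep_contractive s (rep w h); have := hs (rep w h).
  have := nrD (rep s (rep w h)) (rep a (rep w h) *+ 2).
  rewrite -[rep a _ *+ 2]scaler_nat nrZ nr_nat; have := nr_ge0 (rep w h).
  by nra.
have : nr (a *+ 2) <= 1.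
  by have /eqP := w0; rewrite subr_eq0 => /eqP <-.
by rewrite -scaler_nat nrZ nr_nat; lra.
Qed.

(** Otherwise the squarings of a multiple of [a^* a] keep norm [1] while their
    images become arbitrarily small, which [rep_small_le_half] excludes. *)
Lemma rep_isometric a r : 0 <= r -> (forall h, nr (rep a h) <= r * nr h) ->
  nr a <= r.
Proof.
move=> r0 hr; rewrite leNgt; apply/negP => lt_r.
have a0 : 0 < nr a by lra.
pose b := ((nr a)^-1 ^+ 2)%:C *: cmul (star a) a; pose rho := r / nr a.
have rho01 : 0 <= rho < 1 by rewrite divr_ge0 ?nr_ge0 //= ltr_pdivrMr // mul1r.
have /andP[rho0 rho1] := rho01.
have inv0 : 0 <= (nr a)^-1 by rewrite invr_ge0 ltW.
have hb h : nr (rep b h) <= rho * nr h.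
  rewrite /b repZ nrZ nr_real ger0_norm ?exprn_ge0 // repM.
  have h1 := rep_contractive (star a) (rep a h); rewrite nr_star in h1.
  have : nr a * nr (rep a h) <= nr a * (r * nr h) by rewrite ler_pM2l.
  move/(le_trans h1) => {}h1; rewrite expr2 -mulrA.
  rewrite ler_pdivrMl // ler_pdivrMl // (le_trans h1) // /rho.
  rewrite (_ : nr a * (r / nr a * nr h) = r * nr h) //.
  by field; exact: lt0r_neq0.
pose d := fix d (n : nat) := if n is m.+1 then cmul (d m) (d m) else b.
have ds n : star (d n) = d n.
  elim: n => [|n IH] /=; last by rewrite starM IH.
  by rewrite /b starZ starM starK conj_real.
have d1 n : nr (d n) = 1.
  elim: n => [|n IH] /=; last by rewrite nr_sqr_sa // IH expr1n.
  rewrite /b nrZ nr_real ger0_norm ?exprn_ge0 // nr_star_cmul -exprMn mulVf //.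
    by rewrite expr1n.
  exact: lt0r_neq0.
have hd n h : nr (rep (d n) h) <= rho ^+ n.+1 * nr h.
  elim: n h => [|n IH] h //=; rewrite repM; have h1 := IH (rep (d n) h).
  apply: le_trans h1 _; rewrite (exprSr _ n.+1) -mulrA ler_wpM2l ?exprn_ge0 //.
  apply: le_trans (IH h) _; rewrite ler_wpM2r ?nr_ge0 //.
  by rewrite exprS ler_piMr // exprn_ile1 // ltW.
have [N hN] := geo_small rho01 (ltac:(lra) : 0 < 4^-1 :> R).
have := @rep_small_le_half (d N) (ds N) _; rewrite d1 lexx => /(_ isT) h.
have := d1 N.+1; rewrite /= => E; move: h; rewrite E => h.
suff : 1 <= 2^-1 :> R by lra.
apply: h => h; apply: le_trans (hd N.+1 h) _; rewrite ler_wpM2r ?nr_ge0 //.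
by apply/ltW/hN; rewrite leqW.
Qed.

End Representation.

(** * Spectral projections of compact elements *)

Section Compactness.
Context {R : realType} {A : cstarType R} {H : completeNormedModType R[i]}.
Context {form : {dot H for (@Num.conj R[i])}} {rep : A -> {linear H -> H}}.
Context (form_norm : hilbert_form form).
Context (rep_morph : star_representation form rep).
Context (rep_inj : forall a b, rep a =1 rep b -> a = b).
Context (rep_compact : forall a, compact_operator (rep a)).
Implicit Types (a b c e p q r : A) (h l : H).

Lemma rep_isometric_ball a d : 0 <= d ->
  (forall h, nr h <= 1 -> nr (rep a h) <= d) -> nr a <= d.
Proof.
move=> d0 hd; apply: (rep_isometric form_norm rep_morph rep_inj) => // h.
have [->|/eqP/nr_gt0 h0] := eqVneq h 0; first by rewrite raddf0 !nr0 mulr0.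
have := hd ((nr h)^-1%:C *: h).
rewrite linearZ /= !nrZ nr_real ger0_norm ?invr_ge0 ?nr_ge0 //.
by rewrite mulVf ?lt0r_neq0 // => /(_ (lexx _)); rewrite ler_pdivrMl // mulrC.
Qed.

Lemma compact_cluster a (h : nat -> H) : (forall n, nr (h n) <= 1) ->
  exists l, forall d : R, 0 < d -> forall N, exists2 n, (N <= n)%N &
    nr (rep a (h n) - l) < d.
Proof.
move=> h1; have [U hU [cU _]] := rep_compact a.
have [] := cU ((fun n => rep a (h n)) @ \oo).
  exists 0%N => // n _; apply: hU; exists (h n) => //=.
  by rewrite nrE -(rmorph1 (real_complex R)) lecR.
move=> l [_ hl]; exists l => d d0 N.
have d0' : 0 < d%:C by rewrite -(rmorph0 (real_complex R)) ltcR.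
have [|_ [[n /= hn <-] hb]] :=
  hl ((fun n => rep a (h n)) @` [set n | (N <= n)%N]) _ _ (nbhsx_ballx l _ d0').
  by exists N => // n hn; exists n.
exists n => //; move: hb; rewrite -ball_normE /= nrE ltcR.
by rewrite nrBC.
Qed.

(** For want of a unit, [pow a n] is the power of exponent [n + 1]. *)
Fixpoint pow a n : A := if n is m.+1 then cmul a (pow a m) else a.

Lemma powD a m n : cmul (pow a m) (pow a n) = pow a (m + n).+1.
Proof. by elim: m => [|m IH] //=; rewrite -cmulA IH. Qed.

Lemma star_pow a n : star a = a -> star (pow a n) = pow a n.
Proof.
move=> sa; elim: n => [|n IH] //=; rewrite starM IH sa -[a in LHS]/(pow a 0).
by rewrite powD addn0.
Qed.

Lemma nr_pow_le1 a n : nr a <= 1 -> nr (pow a n) <= 1.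
Proof.
move=> a1; elim: n => [|n IH] //=; have := nr_cmul a (pow a n).
have := nr_ge0 a; have := nr_ge0 (pow a n); nra.
Qed.

(** The C*-identity gives the exponents [2^k], and every power divides one of
    these. *)
Lemma nr_pow a n : star a = a -> nr a = 1 -> nr (pow a n) = 1.
Proof.
move=> sa a1; have le1 m : nr (pow a m) <= 1 by rewrite nr_pow_le1 ?a1.
have E k : exists2 m, (k <= m)%N & nr (pow a m) = 1.
  elim: k => [|k [m km m1]]; first by exists 0%N.
  exists (m + m).+1; first by rewrite ltnS (leq_trans km) // leq_addr.
  by rewrite -powD nr_sqr_sa ?star_pow // m1 expr1n.
have [m hm m1] := E n.+1; apply/eqP; rewrite eq_le le1 /= -m1.
rewrite -(subnKC hm) addSn -powD (le_trans (nr_cmul _ _)) //.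
by rewrite ler_piMr ?nr_ge0.
Qed.

Lemma nonincreasing_cauchy (u : nat -> R) : (forall n, 0 <= u n) ->
  (forall n, u n.+1 <= u n) -> forall d : R, 0 < d ->
  exists N, forall n, (N <= n)%N -> u n <= u N < u n + d.
Proof.
move=> u0 um d d0.
have mono : nonincreasing_seq u by apply/nonincreasing_seqP.
have /cvg_ex[l /= /cvgrPdist_lt hl] : cvgn u.
  by apply: nonincreasing_is_cvgn => //; exists 0 => _ [n _ <-].
have [N _ hN] := hl (d / 2) ltac:(lra); exists N => n hn.
have := hN n hn; have := hN N (leqnn N); have := mono _ _ hn.
rewrite /= !ltr_norml; lra.
Qed.

(** With [t k] the square of [|a^k h|], which is nonincreasing,
    [|a^(2n) h - a^(2m) h|^2 = t (2n) + t (2m) - 2 t (n + m)]. *)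
Lemma even_pow_strong_cauchy a h : star a = a -> nr a <= 1 ->
  forall d : R, 0 < d -> exists N, forall n m, (N <= n)%N -> (N <= m)%N ->
    nr (rep (pow a (n + n).+1) h - rep (pow a (m + m).+1) h) < d.
Proof.
move=> sa a1 d d0; pose t k := nr (rep (pow a k) h) ^+ 2.
have t0 k : 0 <= t k by rewrite sqr_ge0.
have tm k : t k.+1 <= t k.
  rewrite /t ler_sqr ?nnegrE ?nr_ge0 //= (repM rep_morph).
  apply: le_trans (rep_contractive form_norm rep_morph _ _) _.
  by rewrite ler_piMl ?nr_ge0.
have [N hN] := nonincreasing_cauchy t0 tm (ltac:(nra) : 0 < d ^+ 2 / 2).
exists N => n m hn hm.
rewrite -ltr_sqr ?nnegrE ?nr_ge0 ?ltW // (nr_sub_sqr form_norm).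
have -> : form (rep (pow a (n + n).+1) h) (rep (pow a (m + m).+1) h) =
    (t (n + m).+1)%:C.
  rewrite /t -(form_sqr form_norm) -!powD !(repM rep_morph).
  rewrite !(rep_adj rep_morph) !star_pow // -!(repM rep_morph) !powD.
  by congr (form _ (rep (pow a _) _)); lia.
have /andP[_ h1] := hN (n + m).+1 ltac:(lia).
have /andP[h2 _] := hN (n + n).+1 ltac:(lia).
have /andP[h3 _] := hN (m + m).+1 ltac:(lia).
by rewrite -!/(t _) /=; lra.
Qed.

(** The even powers of [a] decrease as operators, hence converge pointwise; the
    image of the unit ball under [a^2] being relatively compact, they converge
    uniformly on it, that is, in the operator norm. *)
Lemma even_pow_cvg a : star a = a -> nr a <= 1 ->
  exists e, tends (fun n => pow a (n + n).+1) e.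
Proof.
move=> sa a1.
have [//|hC] := pselect (exists e, tends (fun n => pow a (n + n).+1) e).
exfalso; apply: hC.
suff [e he] : exists e, tends (fun n => pow a (n.+1 + n.+1).+1) e.
  exists e => d d0; have [N hN] := he d d0; exists N.+1 => -[|n] //; exact: hN.
apply: nr_complete => d d0; apply: contrapT => hn.
have H0 (N : nat) : exists x : nat * nat * H,
    [/\ (N <= x.1.1)%N, (N <= x.1.2)%N, nr x.2 <= 1 &
     d / 2 < nr (rep (pow a (x.1.1.+1 + x.1.1.+1).+1 -
                       pow a (x.1.2.+1 + x.1.2.+1).+1) x.2)].
  apply: contrapT => hx; apply: hn; exists N => n m hN hM.
  suff : nr (pow a (n.+1 + n.+1).+1 - pow a (m.+1 + m.+1).+1) <= d / 2 by lra.
  apply: rep_isometric_ball => [|h h1]; first by lra.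
  by rewrite leNgt; apply/negP => hlt; apply: hx; exists (n, m, h).
have [x hx] := choice H0.
have hx1 N : nr (x N).2 <= 1 by case: (hx N).
have [l hl] := compact_cluster (cmul a a) hx1.
have [N hN] := even_pow_strong_cauchy l sa a1 (ltac:(lra) : 0 < d / 4).
have [M hM hd] := hl (d / 8) ltac:(lra) N.
have [h1 h2 _ h3] := hx M; move: h1 h2 h3 hd.
set n := (x M).1.1; set m := (x M).1.2; set h := (x M).2 => h1 h2 h3 hd.
(* The factor [a^2] carries the unit ball near the cluster point [l]. *)
have E k : pow a (k.+1 + k.+1).+1 = cmul (pow a (k + k).+1) (cmul a a).
  by rewrite -[cmul a a]/(pow a 1) powD; congr (pow a _); lia.
pose g := pow a (n + n).+1 - pow a (m + m).+1.
have g2 : nr g <= 2.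
  by have := nrB (pow a (n + n).+1) (pow a (m + m).+1);
    have := nr_pow_le1 (n + n).+1 a1; have := nr_pow_le1 (m + m).+1 a1;
    rewrite /g; lra.
have := hN n m (leq_trans hM h1) (leq_trans hM h2).
have -> : rep (pow a (n + n).+1) l - rep (pow a (m + m).+1) l = rep g l.
  by rewrite /g (repD rep_morph) (repN rep_morph).
have E2 : pow a (n.+1 + n.+1).+1 - pow a (m.+1 + m.+1).+1 = cmul g (cmul a a).
  by rewrite !E /g; calg R.
move: h3; rewrite E2 (repM rep_morph) => h3 h4.
have := rep_contractive form_norm rep_morph g (rep (cmul a a) h - l).
rewrite linearB /= => h5.
have := nrD (rep g (rep (cmul a a) h) - rep g l) (rep g l); rewrite subrK.
have := nr_ge0 (rep (cmul a a) h - l); nra.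
Qed.

Definition isproj p : Prop := star p = p /\ cmul p p = p.

(** The limit of the even powers of [a], which is nonzero as they have norm
    [1]. *)
Lemma spectral_projection a : star a = a -> nr a = 1 -> exists e,
  [/\ isproj e, e <> 0, cmul (cmul a a) e = e &
      forall c, cmul c (cmul a a) = cmul (cmul a a) c -> cmul c e = cmul e c].
Proof.
move=> sa a1; have [e he] := even_pow_cvg sa (ltac:(by rewrite a1) : nr a <= 1).
pose u n := pow a (n + n).+1.
have uS n : u n.+1 = cmul (cmul a a) (u n).
  by rewrite -[cmul a a]/(pow a 1) powD; congr (pow a _); lia.
exists e; split; first split.
- apply: tends_unique (tends_star he) _; apply: tends_ext he => n.
  by rewrite star_pow.
- apply: tends_unique (tends_cmul he he) _.
  apply: tends_ext (tends_sub (f := fun n => (n + n).+1) _ he) => n; last by lia.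
  by rewrite powD.
- move=> e0; have [N hN] := he 1 ltr01; have := hN N (leqnn N).
  by rewrite e0 subr0 nr_pow // ltxx.
- apply: tends_unique (tends_cmul (tends_cst (cmul a a)) he) _.
  by apply: tends_ext (tends_shift 1 he) => n; rewrite add1n -[LHS]/(u n.+1) uS.
- move=> c ca; have cu n : cmul c (u n) = cmul (u n) c.
    by elim: n => [|n IH] //; rewrite uS [LHS]cmulA ca -[LHS]cmulA IH [LHS]cmulA.
  apply: tends_unique (tends_cmul (tends_cst c) he) _.
  by apply: tends_ext (tends_cmul he (tends_cst c)) => n; rewrite -/(u n) cu.
Qed.

(** * Minimal projections *)

Lemma isproj0 : isproj 0.
Proof. by split; rewrite ?star0 ?cmul0l. Qed.

Lemma isproj_sub p r : isproj p -> isproj r -> cmul p r = r -> isproj (p - r).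
Proof.
move=> [ps pp] [rs rr] pr; have rp : cmul r p = r by rewrite -{1}rs -ps -starM pr.
by split; rewrite ?starD ?starN ?ps ?rs // !calgE pp pr rp rr; lmod_over (R[i]).
Qed.

Lemma isproj_add p r : isproj p -> isproj r -> cmul p r = 0 -> isproj (p + r).
Proof.
move=> [ps pp] [rs rr] pr.
have rp : cmul r p = 0 by rewrite -rs -ps -starM pr star0.
by split; rewrite ?starD ?ps ?rs // !calgE pp pr rp rr; lmod_over (R[i]).
Qed.

Lemma nr_proj p : isproj p -> p <> 0 -> nr p = 1.
Proof.
move=> [ps pp] /nr_gt0 p0; have := nr_sqr_sa ps; rewrite pp expr2 => E.
by apply: (mulfI (lt0r_neq0 p0)); rewrite mulr1 -E.
Qed.

Lemma nr_proj_le1 p : isproj p -> nr p <= 1.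
Proof.
have [->|/eqP p0 hp] := eqVneq p 0; first by rewrite nr0.
by rewrite nr_proj.
Qed.

Lemma proj_unit_vector p : isproj p -> p <> 0 ->
  exists h, nr h = 1 /\ rep p h = h.
Proof.
move=> [_ pp] p0; have [h hp] : exists h, rep p h <> 0.
  apply: contrapT => hn; apply: p0; apply: rep_inj => h.
  by rewrite (rep0 rep_morph); apply: contrapT => hp; apply: hn; exists h.
have h0 := nr_gt0 hp; exists ((nr (rep p h))^-1%:C *: rep p h); split.
  by rewrite nrZ nr_real ger0_norm ?invr_ge0 ?nr_ge0 // mulVf ?lt0r_neq0.
by rewrite linearZ /= -(repM rep_morph) pp.
Qed.

Lemma rep_orthogonal p r h l : star p = p -> cmul p r = 0 ->
  form (rep p h) (rep r l) = 0.
Proof.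
move=> ps pr; rewrite (rep_adj rep_morph) ps -(repM rep_morph) pr.
by rewrite (rep0 rep_morph) linear0r.
Qed.

(** Unit vectors in the ranges would have images under [u] at mutual distance
    at least [d], in a relatively compact set. *)
Lemma no_orthogonal_sequence u (e : nat -> A) (d : R) : 0 < d ->
  (forall n, isproj (e n)) -> (forall n, e n <> 0) ->
  (forall n m, (n < m)%N -> cmul (e n) (e m) = 0) ->
  (forall n, cmul u (e n) = cmul (e n) u) ->
  (forall n h, rep (e n) h = h -> d * nr h <= nr (rep u h)) -> False.
Proof.
move=> d0 hp h0 orth ue hd.
have [h hh] := choice (fun n => proj_unit_vector (hp n) (h0 n)).
have h1 n : nr (h n) <= 1 by case: (hh n) => ->.
have [l hl] := compact_cluster u h1.
have [n _ hn] := hl (d / 2) ltac:(lra) 0%N.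
have [m nm hm] := hl (d / 2) ltac:(lra) n.+1.
have [[en1 ehn] [em1 ehm]] := (hh n, hh m).
have un k : rep u (h k) = rep (e k) (rep u (h k)).
  by have [_ E] := hh k; rewrite -(repM rep_morph) -ue (repM rep_morph) E.
have := nr_sub_sqr form_norm (rep u (h n)) (rep u (h m)).
have -> : form (rep u (h n)) (rep u (h m)) = 0.
  by rewrite (un n) (un m) rep_orthogonal ?orth //; case: (hp n).
have := hd n _ ehn; have := hd m _ ehm; rewrite en1 em1 mulr1 /= mul0rn subr0.
have := nr_sub_trans l (rep u (h n)) (rep u (h m)); rewrite (nrBC l).
have := nr_ge0 (rep u (h n) - rep u (h m)); nra.
Qed.

Definition minproj p : Prop :=
  [/\ isproj p, p <> 0 & forall r, isproj r -> cmul p r = r -> r = 0 \/ r = p].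

(** A strictly decreasing sequence of projections has orthogonal nonzero
    differences, which is impossible: Noetherian induction is available. *)
Lemma proj_ind (P : A -> Prop) : P 0 -> (forall p, minproj p -> P p) ->
  (forall p r, isproj p -> isproj r -> cmul p r = 0 ->
     P p -> P r -> P (p + r)) ->
  forall q, isproj q -> P q.
Proof.
move=> P0 Pmin Padd q0 hq0; apply: contrapT => nP0.
pose S := {q | isproj q /\ ~ P q}.
have next (q : S) : exists r : S,
    cmul (sval q) (sval r) = sval r /\ sval r <> sval q.
  case: q => q [hq nP] /=.
  have [r [hr qr r0 rq]] : exists r,
      [/\ isproj r, cmul q r = r, r <> 0 & r <> q].
    apply: contrapT => hn; apply: (nP); apply: Pmin; split=> // [q00|r hr qr].
      by apply: nP; rewrite q00.
    by apply: contrapT => /not_orP[r0 rq]; apply: hn; exists r.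
  have hs := isproj_sub hq hr qr.
  have [nPr|Pr] := pselect (~ P r); first by exists (exist _ r (conj hr nPr)).
  have nPs : ~ P (q - r).
    move=> Ps; apply: nP; rewrite -(subrK r q); apply: Padd => //.
      by case: hr => _ rr; rewrite !calgE qr rr subrr.
    exact: contrapT.
  exists (exist _ (q - r) (conj hs nPs)) => /=; split.
    by case: hq => _ qq; rewrite !calgE qq qr.
  by move=> E; apply: r0; rewrite -(subKr q r) E subrr.
have [f hf] := choice next.
pose s n := sval (iter n f (exist _ q0 (conj hq0 nP0))).
have hs n : isproj (s n) by rewrite /s; case: (iter _ _ _) => ? [].
have sS n : cmul (s n) (s n.+1) = s n.+1.
  by have [] := hf (iter n f (exist _ q0 (conj hq0 nP0))).
have sD n k : cmul (s n) (s (n + k)%N) = s (n + k)%N.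
  elim: k => [|k IH]; first by rewrite addn0; case: (hs n).
  by rewrite addnS -sS cmulA IH.
have sle n m : (n <= m)%N -> cmul (s n) (s m) = s m.
  by move=> nm; rewrite -(subnKC nm).
have sge n m : (n <= m)%N -> cmul (s m) (s n) = s m.
  by move=> nm; have [[E1 _] [E2 _]] := (hs n, hs m); rewrite -{1}E1 -E2 -starM sle.
apply: (@no_orthogonal_sequence q0 (fun n => s n - s n.+1) 1) => //.
- by move=> n; apply: isproj_sub.
- move=> n E; case: (hf (iter n f (exist _ q0 (conj hq0 nP0)))) => _; apply.
  by apply/esym/eqP; rewrite -subr_eq0; apply/eqP.
- move=> n m nm; have h1 : (n <= m)%N by lia.
  have h2 : (n <= m.+1)%N by lia.
  have h3 : (n.+1 <= m.+1)%N by lia.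
  rewrite !calgE (sle _ _ h1) (sle _ _ h2) (sle _ _ nm) (sle _ _ h3).
  by lmod_over (R[i]).
- move=> n; have -> : q0 = s 0%N by [].
  by rewrite !calgE (sle 0%N n) // (sle 0%N n.+1) // (sge 0%N n) // (sge 0%N n.+1).
- move=> n h E; rewrite mul1r; have -> : rep q0 h = h; last by [].
  rewrite -{1}E -(repM rep_morph); have -> : q0 = s 0%N by [].
  by rewrite !calgE !sle.
Qed.

(** A self-adjoint element of norm [1] of the corner has a nonzero spectral
    projection below [p], which is [p]; its square is then [p], so that it is
    the difference of two projections below [p]. *)
Lemma minproj_corner_sa p b : minproj p -> star b = b -> cmul p b = b ->
  exists k : R, b = k%:C *: p.
Proof.
move=> [[ps pp] p0 pmin] bs pb.
have [->|/eqP/nr_gt0 b0] := eqVneq b 0; first by exists 0; rewrite scale0r.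
have bp : cmul b p = b by rewrite -{1}bs -ps -starM pb.
pose c := (nr b)^-1%:C *: b.
have cs : star c = c by rewrite /c starZ conj_real bs.
have c1 : nr c = 1.
  by rewrite nrZ nr_real ger0_norm ?invr_ge0 ?nr_ge0 // mulVf ?lt0r_neq0.
have pc : cmul p c = c by rewrite /c cmulZr pb.
have cp : cmul c p = c by rewrite /c cmulZl bp.
have [e [he e0 ce _]] := spectral_projection cs c1.
have ep : e = p.
  by have [] := pmin e he _ => //; rewrite -ce !cmulA pc.
have cc : cmul c c = p by rewrite -[RHS]ep -ce ep -cmulA cp.
(* Now [(p + c) / 2] is a projection below [p], hence [c] is [p] or [- p]. *)
have bc : b = (nr b)%:C *: c.
  by rewrite /c scalerA -rmorphM /= divff ?lt0r_neq0 // scale1r.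
clearbody c; have hr : isproj (2^-1 *: (p + c)).
  split; first by rewrite starZ starD ps cs fmorphV /= rmorph_nat.
  by rewrite !calgE pp pc cp cc; lmod_over (R[i]).
have cE : c = 2 *: (2^-1 *: (p + c)) - p by lmod_over (R[i]).
have pr : cmul p (2^-1 *: (p + c)) = 2^-1 *: (p + c) by rewrite !calgE pp pc.
have [r0|rp] := pmin _ hr pr.
  by exists (- nr b); rewrite {1}bc cE r0 rmorphN /=; lmod_over (R[i]).
by exists (nr b); rewrite {1}bc cE rp; lmod_over (R[i]).
Qed.

(** The real and imaginary parts of [p a p] are real multiples of [p]. *)
Lemma minproj_corner p a : minproj p -> exists k : R[i],
  cmul (cmul p a) p = k *: p.
Proof.
move=> hp; have [[ps pp] _ _] := hp; have [i [ic ii _]] := imaginary_unit R.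
pose c := cmul (cmul p a) p.
have pc : cmul p c = c by rewrite /c !cmulA pp.
have pcs : cmul p (star c) = star c.
  by rewrite /c !starM ps cmulA pp.
have Ec : cmul (cmul p a) p = c by []; clearbody c.
have half : Num.conj (2^-1 : R[i]) = 2^-1 by rewrite fmorphV /= rmorph_nat.
have [||k1 E1] := @minproj_corner_sa p (2^-1 *: (c + star c)) hp.
- by rewrite starZ half starD starK addrC.
- by rewrite !calgE pc pcs.
have [||k2 E2] := @minproj_corner_sa p ((2^-1 * i) *: (star c - c)) hp.
- by rewrite starZ rmorphM /= half ic starD starN starK; lmod_over (R[i]).
- by rewrite !calgE pc pcs.
exists (k1%:C + i * k2%:C); rewrite Ec scalerDl -scalerA -E1 -E2 scalerA.
rewrite mulrCA ii; lmod_over (R[i]).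
Qed.

End Compactness.

(** * Approximation by projections *)

Section Density.
Context {R : realType} {A : cstarType R} {H : completeNormedModType R[i]}.
Context {form : {dot H for (@Num.conj R[i])}} {rep : A -> {linear H -> H}}.
Context (form_norm : hilbert_form form).
Context (rep_morph : star_representation form rep).
Context (rep_inj : forall a b, rep a =1 rep b -> a = b).
Context (rep_compact : forall a, compact_operator (rep a)).
Implicit Types (a b c e p q r : A) (h l : H).

Let spectral := spectral_projection form_norm rep_morph rep_inj rep_compact.

(** The remainder [b = a - a q] has norm above [d]. Its leading spectral
    projection is orthogonal to [q], so that [a] and [b] agree on it. *)
Lemma proj_orthogonal_step a q (d : R) : star a = a -> isproj q ->
  cmul a q = cmul q a -> 0 < d -> d < nr (a - cmul a q) ->
  exists e, [/\ isproj e, e <> 0, cmul q e = 0, cmul a e = cmul e a &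
    forall h, rep e h = h -> d * nr h <= nr (rep a h)].
Proof.
move=> sa [qs qq] aq d0; set b := a - cmul a q => db; have b0 : 0 < nr b by lra.
have bs : star b = b by rewrite /b starD starN starM qs sa aq.
have qb : cmul q b = 0 by rewrite /b !calgE -aq -cmulA qq subrr.
have ab : cmul a b = cmul b a by rewrite /b !calgE -!cmulA aq.
have hb h : rep q h = 0 -> rep b h = rep a h.
  move=> qh; rewrite /b (repD rep_morph) (repN rep_morph) (repM rep_morph) qh.
  by rewrite raddf0 subr0.
clearbody b; pose c := (nr b)^-1%:C *: b.
have cs : star c = c by rewrite /c starZ conj_real bs.
have c1 : nr c = 1.
  by rewrite nrZ nr_real ger0_norm ?invr_ge0 ?nr_ge0 // mulVf ?lt0r_neq0.
have qc : cmul q c = 0 by rewrite /c cmulZr qb scaler0.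
have ac : cmul a c = cmul c a by rewrite /c cmulZr cmulZl ab.
have [e [he e0 ce ecomm]] := spectral cs c1.
have qe : cmul q e = 0 by rewrite -ce !cmulA qc !cmul0l.
exists e; split=> //; first by apply: ecomm; rewrite cmulA ac -cmulA ac cmulA.
move=> h eh; have qh : rep q h = 0.
  by rewrite -eh -(repM rep_morph) qe (rep0 rep_morph).
have ch : rep c (rep c h) = h by rewrite -{1}eh -!(repM rep_morph) ?cmulA ce.
have := rep_contractive form_norm rep_morph c (rep c h).
rewrite ch c1 mul1r /c (repZ rep_morph) nrZ nr_real ger0_norm ?invr_ge0 ?nr_ge0 //.
rewrite ler_pdivlMl // hb // => h1; apply: le_trans h1.
by rewrite ler_wpM2r ?nr_ge0 // ltW.
Qed.

(** Enlarging [q] by [proj_orthogonal_step] must come to an end. *)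
Lemma proj_approx a q0 (d : R) : star a = a -> isproj q0 ->
  cmul a q0 = cmul q0 a -> 0 < d -> exists q,
  [/\ isproj q, cmul q q0 = q0, cmul a q = cmul q a & nr (a - cmul a q) <= d].
Proof.
move=> sa hq0 aq0 d0; apply: contrapT => hn.
pose S := {q | [/\ isproj q, cmul q q0 = q0 & cmul a q = cmul q a]}.
have next (q : S) : exists r : S, [/\ isproj (sval r - sval q),
    sval r - sval q <> 0, cmul (sval q) (sval r - sval q) = 0 &
    forall h, rep (sval r - sval q) h = h -> d * nr h <= nr (rep a h)].
  case: q => q [hq qq0 aq] /=.
  have dq : d < nr (a - cmul a q).
    by rewrite ltNge; apply/negP => hle; apply: hn; exists q.
  have [e [he e0 qe ae eh]] := proj_orthogonal_step sa hq aq d0 dq.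
  have eq0 : cmul e q0 = 0.
    have eq : cmul e q = 0.
      by case: he hq => [es _] [qs _]; rewrite -es -qs -starM qe star0.
    by rewrite -qq0 cmulA eq cmul0l.
  have hqe : [/\ isproj (q + e), cmul (q + e) q0 = q0 &
      cmul a (q + e) = cmul (q + e) a].
    by split; rewrite ?calgE ?qq0 ?eq0 ?addr0 ?aq ?ae //; apply: isproj_add.
  by exists (exist _ (q + e) hqe); rewrite /= [q + e]addrC addrK.
have [f hf] := choice next.
have hS0 : [/\ isproj q0, cmul q0 q0 = q0 & cmul a q0 = cmul q0 a].
  by split=> //; case: hq0.
pose s n := sval (iter n f (exist _ q0 hS0)).
have hs n : isproj (s n) by rewrite /s; case: (iter _ _ _) => ? [].
have sa' n : cmul a (s n) = cmul (s n) a by rewrite /s; case: (iter _ _ _) => ? [].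
have hs' n : [/\ isproj (s n.+1 - s n), s n.+1 - s n <> 0,
    cmul (s n) (s n.+1 - s n) = 0 &
    forall h, rep (s n.+1 - s n) h = h -> d * nr h <= nr (rep a h)].
  exact: (hf (iter n f (exist _ q0 hS0))).
have sS n : cmul (s n) (s n.+1) = s n.
  have [_ _ h _] := hs' n; move: h; rewrite cmulDr cmulNr.
  by case: (hs n) => _ -> /eqP; rewrite subr_eq0 => /eqP.
have sle n m : (n <= m)%N -> cmul (s n) (s m) = s n.
  move=> nm; rewrite -(subnKC nm); elim: (m - n)%N => [|k IH].
    by rewrite addn0; case: (hs n).
  by rewrite -{1}IH -cmulA addnS sS.
apply: (no_orthogonal_sequence form_norm rep_morph rep_inj rep_compact (u := a)
          (e := fun n => s n.+1 - s n) d0).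
- by move=> n; case: (hs' n).
- by move=> n; case: (hs' n).
- move=> n m nm; rewrite !calgE !sle //; [|lia..]; by lmod_over (R[i]).
- by move=> n; rewrite !calgE !sa'.
- by move=> n; case: (hs' n).
Qed.

Lemma minproj_below e : isproj e -> e <> 0 ->
  exists p, minproj p /\ cmul e p = p.
Proof.
move=> he e0; suff [//|//] : e = 0 \/ exists p, minproj p /\ cmul e p = p.
move: e he {e0}.
apply: (proj_ind form_norm rep_morph rep_inj rep_compact); first by left.
  by move=> p hp; right; exists p; split=> //; case: hp => -[].
move=> p r hp hr pr [->|[p0 [hp0 pp0]]] hr0; first by rewrite add0r.
have rp : cmul r p = 0.
  by case: hp hr => [ps _] [rs _]; rewrite -ps -rs -starM pr star0.
by right; exists p0; split=> //; rewrite cmulDl pp0 -{2}pp0 cmulA rp cmul0l addr0.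
Qed.

End Density.

(** * Hilbert modules over an algebra of compact operators *)

Section HilbertModules.
Context {R : realType} {A : cstarType R} {X : hilbertModType A}.
Implicit Types (x y z : X) (a b : A).

Lemma ract0l a : ract (0 : X) a = 0.
Proof. by have := ractZl 0 (0 : X) a; rewrite !scale0r. Qed.

Lemma ract0r x : ract x 0 = 0.
Proof. by have := ractZr 0 x 0; rewrite !scale0r. Qed.

Lemma ractNl x a : ract (- x) a = - ract x a.
Proof. by rewrite -scaleN1r ractZl scaleN1r. Qed.

Lemma ipNr x y : ip x (- y) = - ip x y.
Proof. by rewrite -scaleN1r ipZr scaleN1r. Qed.

Lemma ip0r x : ip x 0 = 0.
Proof. by have := ipZr 0 x 0; rewrite !scale0r. Qed.

Lemma ipDl x y z : ip (x + y) z = ip x z + ip y z.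
Proof. by rewrite -ip_star ipDr starD !ip_star. Qed.

Lemma ipZl (k : R[i]) x y : ip (k *: x) y = Num.conj k *: ip x y.
Proof. by rewrite -ip_star ipZr starZ ip_star. Qed.

Lemma ipNl x y : ip (- x) y = - ip x y.
Proof. by rewrite -ip_star ipNr starN ip_star. Qed.

Lemma ip0l x : ip 0 x = 0.
Proof. by rewrite -ip_star ip0r star0. Qed.

Lemma ip_ractl x y a : ip (ract x a) y = cmul (star a) (ip x y).
Proof. by rewrite -ip_star ip_ract starM ip_star. Qed.

Definition ipE := (ipDl, @ipDr R A X, ipNl, ipNr, ip_ractl, @ip_ract R A X).

Lemma ip_ext x y : (forall z, ip x z = ip y z) -> x = y.
Proof.
move=> h; apply/eqP; rewrite -subr_eq0; apply/eqP; apply: ip_eq0.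
by rewrite ipDl ipNl h subrr.
Qed.

Lemma nr_ip x : nr (ip x x) = nr x ^+ 2.
Proof.
by apply: complexI; rewrite -nrE rmorphXn /= -nrE norm_ip sqrtCK.
Qed.

Lemma ip_sqr x : exists2 t : A, ip x x = cmul (star t) t & nr t = nr x.
Proof.
have [t E] := ip_positive x; exists t => //; apply/eqP.
by rewrite -(eqrXn2 (n := 2)) ?nr_ge0 // -nr_star_cmul -E nr_ip.
Qed.

Lemma nr_ract x a : nr (ract x a) <= nr x * nr a.
Proof.
have [t E tx] := ip_sqr x.
rewrite -tx -ler_sqr ?nnegrE ?mulr_ge0 ?nr_ge0 // -nr_ip ip_ractl ip_ract E.
have -> : cmul (star a) (cmul (cmul (star t) t) a) =
    cmul (star (cmul t a)) (cmul t a) by rewrite starM !cmulA.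
by rewrite nr_star_cmul ler_sqr ?nnegrE ?mulr_ge0 ?nr_ge0 // nr_cmul.
Qed.

Lemma tends_ract (u : nat -> X) l a :
  tends u l -> tends (fun n => ract (u n) a) (ract l a).
Proof.
apply: (tends_lip (f := fun x => ract x a) (K := nr a)) => x y.
by rewrite -ractNl -ractDl mulrC nr_ract.
Qed.

Context {H : completeNormedModType R[i]}.
Context {form : {dot H for (@Num.conj R[i])}} {rep : A -> {linear H -> H}}.
Context (form_norm : hilbert_form form).
Context (rep_morph : star_representation form rep).
Context (rep_inj : forall a b, rep a =1 rep b -> a = b).

(** With [|x| = 1] and [a = <x, y>], positivity of [<x a - y, x a - y>] gives
    [a^* a <= <y, y>], an inequality between operators. *)
Lemma cauchy_schwarz x y : nr (ip x y) <= nr x * nr y.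
Proof.
have main u : nr u = 1 -> nr (ip u y) <= nr y.
  move=> u1; set a := ip u y; apply: (rep_isometric form_norm rep_morph rep_inj).
    exact: nr_ge0.
  move=> h; have [t Et tu] := ip_sqr u; have [w Ew wy] := ip_sqr y.
  have [v Ev _] := ip_sqr (ract u a - y).
  have : form h (rep (ip (ract u a - y) (ract u a - y)) h) =
    form h (rep (cmul (star (cmul t a)) (cmul t a)) h)
    - form h (rep (cmul (star a) a) h) *+ 2 + form h (rep (ip y y) h).
    have ya : ip y u = star a by rewrite -ip_star.
    have -> : ip (ract u a - y) (ract u a - y) =
        cmul (star (cmul t a)) (cmul t a) - cmul (star a) a *+ 2 + ip y y.
      rewrite !ipE Et ya -/a.
      by calg R.
    rewrite !(repD rep_morph) (repN rep_morph) (repMn rep_morph).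
    by rewrite !linearDr !linearNr linearMnr.
  rewrite Ew Ev !(form_rep_sqr form_norm rep_morph) (repM rep_morph).
  rewrite -rmorphMn -rmorphB -rmorphD => /complexI E.
  have := rep_contractive form_norm rep_morph t (rep a h).
  have := rep_contractive form_norm rep_morph w h; rewrite tu u1 mul1r wy => h1 h2.
  have h3 : nr (rep t (rep a h)) ^+ 2 <= nr (rep a h) ^+ 2.
    by rewrite ler_sqr ?nnegrE ?nr_ge0.
  have h4 : nr (rep w h) ^+ 2 <= (nr y * nr h) ^+ 2.
    by rewrite ler_sqr ?nnegrE ?mulr_ge0 ?nr_ge0.
  rewrite -ler_sqr ?nnegrE ?mulr_ge0 ?nr_ge0 //.
  by have := sqr_ge0 (nr (rep v h)); lra.
have [->|/eqP/nr_gt0 x0] := eqVneq x 0; first by rewrite ip0l !nr0 mul0r.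
have := main ((nr x)^-1%:C *: x); rewrite ipZl conj_real !nrZ nr_real.
rewrite ger0_norm ?invr_ge0 ?nr_ge0 // mulVf ?lt0r_neq0 // => /(_ erefl).
by rewrite ler_pdivrMl.
Qed.

Lemma tends_ipl (u : nat -> X) l y :
  tends u l -> tends (fun n => ip (u n) y) (ip l y).
Proof.
apply: (tends_lip (f := fun x => ip x y) (K := nr y)) => x z.
by rewrite -ipNl -ipDl mulrC cauchy_schwarz.
Qed.

Context (rep_compact : forall a, compact_operator (rep a)).

Lemma module_proj_approx x (d : R) : 0 < d ->
  exists2 q : A, isproj q & nr (x - ract x q) <= d.
Proof.
move=> d0; have d2 : 0 < d ^+ 2 by rewrite exprn_gt0.
have a0 : cmul (ip x x) 0 = cmul 0 (ip x x) by rewrite cmul0l cmul0r.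
have [q [[qs qq] _ aq hq]] := proj_approx form_norm rep_morph rep_inj
  rep_compact (ip_star x x) (isproj0 (A := A)) a0 d2.
exists q => //; rewrite -ler_sqr ?nnegrE ?nr_ge0 ?(ltW d0) // -nr_ip.
rewrite (_ : ip _ _ = ip x x - cmul (ip x x) q) //.
rewrite !ipE qs !calgE -aq -cmulA qq.
by lmod_over (R[i]).
Qed.

(** A property of the slices [X p] reaches [X p] for all projections [p] by
    Noetherian induction, and then all of [X], as [x p] can be close to [x]. *)
Lemma module_density (P : X -> Prop) : P 0 ->
  (forall p x, minproj p -> P (ract x p)) ->
  (forall x y, P x -> P y -> P (x + y)) ->
  (forall u l, (forall n, P (u n)) -> tends u l -> P l) -> forall x, P x.
Proof.
move=> P0 Pmin Padd Plim x.
have Pq q : isproj q -> P (ract x q).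
  move: q; apply: (proj_ind form_norm rep_morph rep_inj rep_compact).
  - by rewrite ract0r.
  - by move=> p; apply: Pmin.
  - by move=> p r _ _ _ Pp Pr; rewrite ractDr; apply: Padd.
have half n : 0 < (2^-1 : R) ^+ n by rewrite exprn_gt0 // invr_gt0.
have approx n : exists q, isproj q /\ nr (x - ract x q) <= 2^-1 ^+ n.
  by have [q] := module_proj_approx x (half n); exists q.
have [q hq] := choice approx.
apply: (Plim (fun n => ract x (q n))) => [n|]; first by apply: Pq; case: (hq n).
apply: (tends_squeeze (r := 2^-1) (c := 1)) => [|n]; first by apply/andP; split; lra.
by rewrite mul1r nrBC; case: (hq n).
Qed.

(** The largest eigenvalue of the positive compact operator [<x, x>] is its
    norm. *)
Lemma norm_attained x : x <> 0 -> exists2 p : A, minproj p &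
  nr (ract x p) = nr x.
Proof.
move=> /nr_gt0 x0; set n2 := nr x ^+ 2; have n0 : 0 < n2 by rewrite exprn_gt0.
pose c := n2^-1%:C *: ip x x.
have cs : star c = c by rewrite /c starZ conj_real ip_star.
have c1 : nr c = 1.
  by rewrite nrZ nr_real nr_ip ger0_norm ?invr_ge0 ?(ltW n0) // mulVf ?lt0r_neq0.
have [e [he e0 ce _]] :=
  spectral_projection form_norm rep_morph rep_inj rep_compact cs c1.
(* Since [c] is positive, [c^2 e = e] already implies [c e = e]. *)
have {}ce : cmul c e = e.
  apply/eqP; rewrite -subr_eq0; apply/eqP; apply: rep_inj => h.
  rewrite (rep0 rep_morph); set w := cmul c e - e.
  have cw : cmul c w = - w by rewrite /w cmulDr cmulNr cmulA ce opprB.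
  have [t Et _] := ip_sqr x.
  have := form_rep_sqr form_norm rep_morph t (rep w h).
  have -> : cmul (star t) t = n2%:C *: c.
    by rewrite -Et /c scalerA -rmorphM /= divff ?lt0r_neq0 // scale1r.
  rewrite (repZ rep_morph) -(repM rep_morph) cw (repN rep_morph) formZr.
  rewrite formNr (form_sqr form_norm) conj_real -rmorphN -rmorphM /= => -[E].
  apply: nr_eq0; apply/eqP; rewrite -sqrf_eq0.
  have := sqr_ge0 (nr (rep t (rep w h))); have := sqr_ge0 (nr (rep w h)).
  by rewrite -E => h1 h2; rewrite eq_le h1 andbT; nra.
have [p [hp ep]] := minproj_below form_norm rep_morph rep_inj rep_compact he e0.
exists p => //; have [hpp p0 _] := hp; have [ps pp] := hpp.
have cp : cmul c p = p by rewrite -ep cmulA ce.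
apply/eqP; rewrite -(eqrXn2 (n := 2)) ?nr_ge0 // -nr_ip ip_ractl ip_ract ps.
have -> : ip x x = n2%:C *: c.
  by rewrite /c scalerA -rmorphM /= divff ?lt0r_neq0 // scale1r.
rewrite cmulZl cmulZr cp pp nrZ nr_real (nr_proj hpp p0) mulr1 ger0_norm //.
exact: ltW.
Qed.

End HilbertModules.

(** * Pure states of minimal projections *)

Lemma linear_of (R : realType) (U : lmodType R[i]) (V : zmodType)
    (s : GRing.Scale.law R[i] V) (F : U -> V) :
  linear_for s F -> exists G : {linear U -> V | s}, forall u, G u = F u.
Proof.
move=> hF; pose L := GRing.isLinear.Build R[i] U V s F hF.
by exists (HB.pack_for {linear U -> V | s} F L).
Qed.

Section PureStates.
Context {R : realType} {A : cstarType R} {H : completeNormedModType R[i]}.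
Context {form : {dot H for (@Num.conj R[i])}} {rep : A -> {linear H -> H}}.
Context (form_norm : hilbert_form form).
Context (rep_morph : star_representation form rep).
Context (rep_inj : forall a b, rep a =1 rep b -> a = b).
Context (rep_compact : forall a, compact_operator (rep a)).
Implicit Types (a b c p q y : A) (h : H) (f g : {scalar A}).

Lemma nr_sub_projr a q : isproj q ->
  cmul (cmul (star a) a) q = cmul q (cmul (star a) a) ->
  nr (a - cmul a q) ^+ 2 = nr (cmul (star a) a - cmul (cmul (star a) a) q).
Proof.
move=> [qs qq] aq; rewrite -nr_star_cmul; congr nr.
rewrite starD starN starM qs cmulDr cmulNr !cmulDl !cmulNl.
rewrite -(cmulA q (star a) a) -aq (cmulA (cmul q (star a))).
by rewrite -(cmulA q (star a) a) -aq -(cmulA _ q q) qq (cmulA (star a)) ?calgE;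
  lmod_over (R[i]).
Qed.

(** The spectral projections [q n] of [a^* a] increase fast enough for
    [y = sum 2^n a (q n.+1 - q n)] and [b = sum 2^-n (q n.+1 - q n)] to
    converge. *)
Lemma factorization a : exists y b, a = cmul y b.
Proof.
pose c := cmul (star a) a; have cs : star c = c by rewrite /c starM starK.
pose S := {q | isproj q /\ cmul c q = cmul q c}.
have step (nq : nat * S) : exists r : S,
    cmul (sval r) (sval nq.2) = sval nq.2 /\
    nr (a - cmul a (sval r)) <= (4^-1) ^+ nq.1.
  case: nq => n [q [hq cq]] /=.
  have d0 : 0 < ((4^-1 : R) ^+ n) ^+ 2 by rewrite !exprn_gt0 // invr_gt0.
  have [r [hr rq cr hle]] := proj_approx form_norm rep_morph rep_inj rep_compact
    cs hq cq d0.
  exists (exist _ r (conj hr cr)); split=> //=.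
  rewrite -ler_sqr ?nnegrE ?nr_ge0 ?exprn_ge0 ?invr_ge0 //.
  by rewrite nr_sub_projr.
have [F hF] := choice step.
have h0 : isproj (0 : A) /\ cmul c 0 = cmul 0 c.
  by rewrite cmul0l cmul0r; split=> //; exact: isproj0.
pose s := fix s n : S :=
  if n is m.+1 then F (m.+1, s m) else F (0%N, exist _ 0 h0).
pose q n := sval (s n).
have hq n : isproj (q n) by rewrite /q; case: (s n) => ? [].
have qS n : cmul (q n.+1) (q n) = q n by have [] := hF (n.+1, s n).
have qS' n : cmul (q n) (q n.+1) = q n.
  by case: (hq n) (hq n.+1) => [e1 _] [e2 _]; rewrite -e1 -e2 -starM qS.
have aq n : nr (a - cmul a (q n)) <= 4^-1 ^+ n.
  case: n => [|n]; first by have [] := hF (0%N, exist _ 0 h0).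
  by have [] := hF (n.+1, s n).
clearbody q; clear - hq qS qS' aq.
(* The increments of [y] and [b] are of order [2^n 4^-n] and [2^-n]. *)
pose d n := q n.+1 - q n.
have hd n : isproj (d n) by apply: isproj_sub.
have dq n : cmul (d n) (q n) = 0.
  by rewrite /d !calgE qS; case: (hq n) => _ ->; rewrite subrr.
have qd n : cmul (q n) (d n) = 0.
  by rewrite /d !calgE qS'; case: (hq n) => _ ->; rewrite subrr.
have q'd n : cmul (q n.+1) (d n) = d n.
  by rewrite /d !calgE qS; case: (hq n.+1) => _ ->.
have dq' n : cmul (d n) (q n.+1) = d n.
  by rewrite /d !calgE qS'; case: (hq n.+1) => _ ->.
have qE n : q n.+1 = q n + d n by rewrite /d addrC subrK.
have ad n : nr (cmul a (d n)) <= 2 * 4^-1 ^+ n.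
  have -> : cmul a (d n) = (a - cmul a (q n)) - (a - cmul a (q n.+1)).
    by rewrite /d; calg R.
  have := nrB (a - cmul a (q n)) (a - cmul a (q n.+1)).
  have := aq n; have := aq n.+1; rewrite exprS.
  have : 0 <= (4^-1 : R) ^+ n by rewrite exprn_ge0 // invr_ge0.
  lra.
clearbody d.
pose y := fix y n := if n is m.+1 then y m + (2 ^+ m : R)%:C *: cmul a (d m)
                     else cmul a (q 0%N).
pose b := fix b n := if n is m.+1 then b m + (2^-1 ^+ m : R)%:C *: d m else q 0%N.
have inv n : [/\ cmul (y n) (q n) = y n, cmul (q n) (b n) = b n &
                 cmul (y n) (b n) = cmul a (q n)].
  elim: n => [|n [IH1 IH2 IH3]] /=.
    by case: (hq 0%N) => _ qq; rewrite -cmulA qq.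
  have yd : cmul (y n) (d n) = 0 by rewrite -IH1 -cmulA qd cmul0r.
  have db : cmul (d n) (b n) = 0 by rewrite -IH2 cmulA dq cmul0l.
  have yq : cmul (y n) (q n.+1) = y n by rewrite -IH1 -cmulA qS'.
  have qb : cmul (q n.+1) (b n) = b n by rewrite -IH2 cmulA qS.
  have dd : cmul (d n) (d n) = d n by case: (hd n).
  split.
  - by rewrite cmulDl cmulZl yq -cmulA dq'.
  - by rewrite cmulDr cmulZr qb q'd.
  - rewrite cmulDl !cmulDr !cmulZl !cmulZr IH3 yd -!cmulA db dd scalerA -rmorphM.
    by rewrite -exprMn divff // expr1n qE !calgE; lmod_over (R[i]).
have pos2 k : 0 <= (2^-1 : R) ^+ k by rewrite exprn_ge0 // invr_ge0.
have [l hl] : exists l, tends y l.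
  apply: (nr_complete_geometric (C := 2)) => n.
  rewrite /= [y n + _]addrC addrK nrZ nr_real ger0_norm ?exprn_ge0 //.
  have E : (2^-1 : R) ^+ n = 2 ^+ n * 4^-1 ^+ n.
    by rewrite -exprMn; congr (_ ^+ _); lra.
  rewrite E mulrCA ler_wpM2l ?exprn_ge0 //.
have [m hm] : exists m, tends b m.
  apply: (nr_complete_geometric (C := 1)) => n.
  rewrite /= [b n + _]addrC addrK nrZ nr_real ger0_norm // mul1r.
  by rewrite ler_piMr // nr_proj_le1.
exists l, m; apply: tends_unique (tends_cmul hl hm).
apply: (tends_squeeze (r := 4^-1) (c := 1)); first by apply/andP; split; lra.
by move=> n; case: (inv n) => _ _ ->; rewrite mul1r nrBC.
Qed.

Lemma proj_scale_inj p (k l : R[i]) : p <> 0 -> k *: p = l *: p -> k = l.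
Proof.
move=> p0 /eqP; rewrite -subr_eq0 -scalerBl scaler_eq0 subr_eq0.
by case/orP => [/eqP|/eqP].
Qed.

Lemma corner_functional p : minproj p ->
  exists f : {scalar A}, forall a, cmul (cmul p a) p = f a *: p.
Proof.
move=> hp; have p0 : p <> 0 by case: hp.
have [F hF] := choice (fun a => minproj_corner form_norm rep_morph rep_inj
  rep_compact a hp).
have [|G hG] := @linear_of R A R[i] *%R F; last by exists G => a; rewrite hG.
move=> k a b; apply: (proj_scale_inj p0); rewrite -hF.
rewrite cmulDr cmulDl cmulZr cmulZl !hF scalerA -scalerDl //.
Qed.

Section Corner.
Context {p : A} {f : {scalar A}}.
Context (hp : minproj p) (hf : forall a, cmul (cmul p a) p = f a *: p).

Let p0 : p <> 0. Proof. by case: hp. Qed.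
Let ps : star p = p. Proof. by case: hp => -[]. Qed.
Let pp : cmul p p = p. Proof. by case: hp => -[]. Qed.
Let p1 : nr p = 1. Proof. by apply: nr_proj p0; case: hp. Qed.

Lemma nr_corner a : nr (f a) = nr (cmul (cmul p a) p).
Proof. by rewrite hf nrZ p1 mulr1. Qed.

Lemma corner_p : f p = 1.
Proof. by apply: (proj_scale_inj p0); rewrite -hf !pp scale1r. Qed.

Lemma corner_eq a b : cmul (cmul p a) p = cmul (cmul p b) p -> f a = f b.
Proof. by rewrite !hf => /(proj_scale_inj p0). Qed.

(** In a unit vector [h] of the range of [p], [f (a^* a)] is [|a h|^2]. *)
Lemma corner_sqr a : exists2 r : R, 0 <= r & f (cmul (star a) a) = r%:C.
Proof.
have [h [h1 ph]] := proj_unit_vector rep_morph rep_inj (conj ps pp) p0.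
exists (nr (rep (cmul a p) h) ^+ 2); first exact: sqr_ge0.
have := form_rep_sqr form_norm rep_morph (cmul a p) h.
have -> : cmul (star (cmul a p)) (cmul a p) = f (cmul (star a) a) *: p.
  by rewrite -hf starM ps !cmulA.
rewrite (repZ rep_morph) ph formZr (form_sqr form_norm) h1 expr1n mulr1.
by move/(congr1 Num.conj); rewrite conj_real conjCK.
Qed.

Lemma corner_positive : positive_functional f.
Proof. by move=> _ [a ->]; have [r r0 ->] := corner_sqr a; rewrite ler0c. Qed.

Lemma corner_sqr0 c : cmul c p = 0 -> f (cmul (star c) c) = 0.
Proof.
move=> cp; apply: (proj_scale_inj p0); rewrite -hf -!cmulA cp !cmul0r.
by rewrite scale0r.
Qed.

Lemma nr_corner_le a : nr (f a) <= nr a.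
Proof.
rewrite nr_corner; have := nr_cmul (cmul p a) p; have := nr_cmul p a.
by rewrite p1 mulr1 mul1r => h1 h2; apply: le_trans h2 h1.
Qed.

Lemma corner_state : state f.
Proof.
split; first exact: corner_positive.
split=> [_ [a /= a1 <-]|u hu].
  move: a1; rewrite !nrE -(rmorph1 (real_complex R)) !lecR => a1.
  exact: le_trans (nr_corner_le a) a1.
by rewrite -(normr1 R[i]) -corner_p; apply: hu; exists p; rewrite //= nrE p1.
Qed.

End Corner.

Lemma affine_ge0_slope0 (u s : R[i]) :
  (forall r : R, 0 <= u + r%:C * s) -> s = 0.
Proof.
case: u s => [u1 u2] [s1 s2] h.
have {}h r : u2 + r * s2 = 0 /\ 0 <= u1 + r * s1.
  have := h r; rewrite lecE /= !mul0r subr0 addr0 => /andP[/eqP <- ->]; split=> //.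
have s20 : s2 = 0 by have [e0 _] := h 0; have [e1 _] := h 1; lra.
suff -> : s1 = 0 by rewrite s20.
apply: contrapT => /eqP s10; have [_] := h (- (u1 + 1) / s1).
by rewrite divfK //; lra.
Qed.

(** The degenerate case of the Cauchy-Schwarz inequality for the form
    [g (b^* c)]. *)
Lemma positive_null g c : positive_functional g -> g (cmul (star c) c) = 0 ->
  forall b, g (cmul (star b) c) = 0 /\ g (cmul (star c) b) = 0.
Proof.
move=> gpos gc b; set v := g _; set w := g _.
have hz z : 0 <= g (cmul (star b) b) + (z * v + Num.conj z * w).
  have : cpositive (cmul (star (b + z *: c)) (b + z *: c)) by exists (b + z *: c).
  move/gpos; rewrite starD starZ cmulDl !cmulDr !cmulZl !cmulZr.
  by rewrite !linearD !linearZ /= gc !mulr0 addr0 -/v -/w addrA.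
have [i [ic ii _]] := imaginary_unit R.
have h1 : v + w = 0.
  by apply: (affine_ge0_slope0 (u := g (cmul (star b) b))) => r;
    rewrite mulrDr -{2}(conj_real r).
have h2 : i * (v - w) = 0.
  apply: (affine_ge0_slope0 (u := g (cmul (star b) b))) => r.
  have := hz (r%:C * i); rewrite rmorphM /= ic conj_real.
  by congr (0 <= _ + _); ring.
have i0 : i != 0.
  by apply/eqP => E; move/eqP: ii; rewrite E mul0r eq_sym oppr_eq0 oner_eq0.
move/eqP: h2; rewrite mulf_eq0 (negbTE i0) /= subr_eq0 => /eqP E.
move: h1; rewrite E -mulr2n => /eqP; rewrite mulrn_eq0 /= => /eqP w0.
by rewrite w0.
Qed.

(** A positive functional below [f] is null on the squares of the elements that
    [p] annihilates on the right, hence by factorization depends on [p a p]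
    only. *)
Lemma corner_pure p f : minproj p -> (forall a, cmul (cmul p a) p = f a *: p) ->
  pure_state f.
Proof.
move=> hp hf; split; first exact: (corner_state hp hf).
have [[ps pp] p0 _] := hp.
move=> g gpos gf.
have null c b : cmul c p = 0 ->
    g (cmul (star b) c) = 0 /\ g (cmul (star c) b) = 0.
  move=> cp; apply: (positive_null gpos).
  have hc : cpositive (cmul (star c) c) by exists c.
  apply/eqP; rewrite eq_le gpos // andbT.
  by rewrite -(corner_sqr0 hp hf cp) gf.
have g1 a : g a = g (cmul a p).
  have [y [b ->]] := factorization a.
  have [|E _] := null (b - cmul b p) (star y).
    by rewrite !calgE -cmulA pp subrr.
  move/eqP: E; rewrite starK cmulDr cmulNr linearB subr_eq0 => /eqP ->.
  by rewrite cmulA.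
have g2 a : g (cmul a p) = g (cmul (cmul p a) p).
  pose c := cmul p (star a) - cmul (cmul p (star a)) p.
  have cp : cmul c p = 0 by rewrite /c !calgE -[X in _ - X]cmulA pp subrr.
  have [_ E] := null c p cp; move/eqP: E.
  have -> : cmul (star c) p = cmul a p - cmul (cmul p a) p.
    rewrite /c !calgE ps -[cmul (cmul (cmul p a) p) p]cmulA.
    by rewrite -[cmul (cmul a p) p]cmulA pp.
  by rewrite linearB subr_eq0 => /eqP.
have hpos : cpositive p by exists p; rewrite ps pp.
have gp0 := gpos _ hpos; have gp1 := gf _ hpos.
have gpE : g p = (complex.Re (g p))%:C by rewrite RRe_real // ger0_real.
exists (complex.Re (g p)).
  by rewrite -ler0c -lecR -gpE gp0 /= (le_trans gp1) // (corner_p hp hf).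
by move=> a; rewrite g1 g2 hf linearZ /= -gpE mulrC.
Qed.

Lemma corner_ip (X : hilbertModType A) p f (x : X) : minproj p ->
  (forall a, cmul (cmul p a) p = f a *: p) -> ract x p = x ->
  ip x x = (nr x ^+ 2)%:C *: p.
Proof.
move=> hp hf xp; have [[ps pp] p0 _] := hp.
have E1 : ip x x = f (ip x x) *: p.
  by rewrite -hf -{1 2}xp ip_ractl ip_ract ps cmulA.
have [t Et tx] := ip_sqr x; have [r r0 Er] := corner_sqr hp hf t.
rewrite E1 Et Er; congr (_%:C *: _); rewrite -nr_ip E1 Et Er nrZ nr_real.
by rewrite (nr_proj _ p0) ?mulr1 ?ger0_norm.
Qed.

(** Any positive square root [b] of [nr x ^+ 2 *: p] commutes with [p], hence
    lies in the corner and is a multiple of [p]. *)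
Lemma corner_modabs (X : hilbertModType A) p f (x : X) : minproj p ->
  (forall a, cmul (cmul p a) p = f a *: p) -> ract x p = x ->
  f (modabs x) = (nr x)%:C.
Proof.
move=> hp hf xp; have [[ps pp] p0 _] := hp.
have E := corner_ip hp hf xp.
have [] : [set b : A | cpositive b /\ cmul b b = ip x x] (modabs x).
  rewrite /modabs /csqrt; apply: getPex.
  exists ((nr x)%:C *: p); split.
    exists ((Num.sqrt (nr x))%:C *: p).
    rewrite starZ conj_real ps cmulZl cmulZr pp scalerA -rmorphM /= -expr2.
    by rewrite sqr_sqrtr ?nr_ge0.
  by rewrite cmulZl cmulZr pp scalerA -rmorphM /= E expr2.
move: (modabs x) => b [t bt] bb.
have bs : star b = b by rewrite bt starM starK.
have [x0|/nr_gt0 x0] := pselect (x = 0).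
  have : nr (cmul b b) = 0 by rewrite bb x0 ip0l nr0.
  rewrite nr_sqr_sa // => /eqP; rewrite sqrf_eq0 => /eqP /nr_eq0 ->.
  by rewrite linear0 x0 nr0.
have n0 : (nr x ^+ 2)%:C != 0 :> R[i].
  by rewrite -(rmorph0 (real_complex R)) (inj_eq (@complexI R)) sqrf_eq0 lt0r_neq0.
have bp : cmul b p = cmul p b.
  apply: (scalerI n0); rewrite -cmulZr -cmulZl -E -bb cmulA //.
have cc : nr (b - cmul b p) ^+ 2 = 0.
  rewrite -nr_sqr_sa; last by rewrite starD starN starM bs ps bp.
  have -> : cmul (b - cmul b p) (b - cmul b p) = cmul b b - cmul (cmul b b) p.
    rewrite !calgE -[cmul (cmul b p) b]cmulA -bp !cmulA.
    rewrite -[cmul (cmul _ p) p]cmulA pp.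
    by lmod_over (R[i]).
  by rewrite bb E cmulZl pp subrr nr0.
have {}cc : b = cmul b p.
  by move/eqP: cc; rewrite sqrf_eq0 => /eqP/nr_eq0/eqP; rewrite subr_eq0 => /eqP.
have bE : b = f b *: p by rewrite -hf -bp -cmulA pp.
have [r r0 Er] := corner_sqr hp hf t; rewrite -bt in Er; rewrite Er.
have : r%:C * r%:C = (nr x ^+ 2)%:C.
  by apply: (proj_scale_inj p0); rewrite -E -bb bE Er cmulZl cmulZr pp scalerA.
rewrite -rmorphM => /complexI; rewrite -expr2 => /eqP.
by rewrite eqrXn2 ?nr_ge0 // => /eqP ->.
Qed.

End PureStates.

(** * The symmetric Lax-Milgram theorem *)

Section SymmetricLaxMilgram.
Context {R : realType} {V : completeNormedModType R[i]}.
Context {W : V -> Prop} {Q : V -> V -> R[i]} {phi : V -> R[i]} {m M C : R}.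
Context (W0 : W 0) (WD : forall u v, W u -> W v -> W (u + v)).
Context (WZ : forall (k : R[i]) u, W u -> W (k *: u)).
Context (Wclosed : forall (u : nat -> V) l,
  (forall n, W (u n)) -> tends u l -> W l).
Context (QD : forall u v w, Q u (v + w) = Q u v + Q u w).
Context (QZ : forall (k : R[i]) u v, Q u (k *: v) = k * Q u v).
Context (QC : forall u v, Q v u = Num.conj (Q u v)).
Context (phiD : forall u v, phi (u + v) = phi u + phi v).
Context (phiZ : forall (k : R[i]) u, phi (k *: u) = k * phi u).
Context (m0 : 0 < m).
Context (Qm : forall u, W u -> m * nr u ^+ 2 <= complex.Re (Q u u)).
Context (QM : forall u v, nr (Q u v) <= M * nr u * nr v).
Context (phiC : forall u, nr (phi u) <= C * nr u).
Implicit Types (u v w : V) (r : R).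

Lemma nr_ge_Re (z : R[i]) : `|complex.Re z| <= nr z.
Proof. by rewrite -lecR -nrE normc_ge_Re. Qed.

Let J u := complex.Re (Q u u) - 2 * complex.Re (phi u).
Let q u v := complex.Re (Q u v).

Let qC u v : q v u = q u v.
Proof. by rewrite /q QC; case: (Q u v). Qed.

Let qDr u v w : q u (v + w) = q u v + q u w.
Proof. by rewrite /q QD raddfD. Qed.

Let qZr r u v : q u (r%:C *: v) = r * q u v.
Proof. by rewrite /q QZ; case: (Q u v) => a b /=; rewrite mul0r subr0. Qed.

Let J_expand r u w : J (u + r%:C *: w) =
  J u + 2 * r * (q u w - complex.Re (phi w)) + r ^+ 2 * q w w.
Proof.
rewrite /J -!/(q _ _) !qDr ![q (u + _) _]qC !qDr qZr ![q (_ *: _) _]qC !qZr.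
rewrite phiD phiZ raddfD /= [q (_ *: w) w]qC qZr.
by case: (phi w) => a b /=; ring.
Qed.

Let J_ge u : W u -> - (C ^+ 2 / m) <= J u.
Proof.
move=> hu; have := Qm hu; have := phiC u; have := nr_ge_Re (phi u).
have := ler_norm (complex.Re (phi u)); rewrite /J.
move: (nr u) (nr (phi u)) (complex.Re (Q u u)) (complex.Re (phi u)) `|_|.
move=> n a b c d h1 h2 h3 h4.
suff : - (C ^+ 2 / m) <= m * n ^+ 2 - 2 * (C * n) by lra.
have -> : m * n ^+ 2 - 2 * (C * n) = m * (n - C / m) ^+ 2 - C ^+ 2 / m.
  by field; exact: lt0r_neq0.
by rewrite lerDr mulr_ge0 ?sqr_ge0 // ltW.
Qed.

Let E : set R := [set J u | u in [set u | W u]].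

Let j := inf E.

Let E_inf : has_inf E.
Proof.
split; first by exists (J 0), 0.
by exists (- (C ^+ 2 / m)) => _ [u hu <-]; apply: J_ge.
Qed.

Let j_le u : W u -> j <= J u.
Proof. by move=> hu; apply: ge_inf; [case: E_inf | exists u]. Qed.

Let parallelogram u v : W u -> W v ->
  m * nr (u - v) ^+ 2 <= 2 * (J u + J v - 2 * j).
Proof.
move=> hu hv; have huv : W (u - v) by rewrite -scaleN1r; apply/WD/WZ.
apply: (le_trans (Qm huv)); have := j_le (WZ (2^-1) (WD hu hv)).
have -> : 2^-1 *: (u + v) = v + (2^-1 : R)%:C *: (u - v).
  have -> : (2^-1 : R)%:C = 2^-1 :> R[i] by rewrite fmorphV /= rmorph_nat.
  by lmod_over (R[i]).
have Eu : u = v + (1 : R)%:C *: (u - v) by rewrite rmorph1 scale1r addrC subrK.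
have := J_expand 1 v (u - v); rewrite -Eu J_expand -/(q _ _) => ->; lra.
Qed.

(** The minimiser over [W] of [Q u u - 2 Re (phi u)]: minimising sequences are
    Cauchy by the parallelogram law. *)
Lemma symmetric_lax_milgram : exists2 v, W v & forall w, W w -> Q v w = phi w.
Proof.
have pos n : 0 < (2^-1 : R) ^+ n by rewrite exprn_gt0 // invr_gt0.
have hu n : exists u, W u /\ J u < j + 2^-1 ^+ n.
  by have [_ [u hu <-] h] := inf_adherent (pos n) E_inf; exists u.
have {hu} [u hu] := choice hu.
have r01 : 0 <= (2^-1 : R) < 1 by apply/andP; split; lra.
have [v hv] : exists v, tends u v.
  apply: nr_complete => d d0.
  have e0 : 0 < m * d ^+ 2 / 4 by rewrite divr_gt0 // mulr_gt0 // exprn_gt0.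
  have [N hN] := geo_small r01 e0; exists N => n k hn hk.
  have [[Wn Jn] [Wk Jk]] := (hu n, hu k).
  have := parallelogram Wn Wk; have := hN n hn; have := hN k hk => h1 h2 h3.
  rewrite -ltr_sqr ?nnegrE ?nr_ge0 ?(ltW d0) // -(ltr_pM2l m0); lra.
have Wv : W v by apply: (Wclosed _ hv) => n; case: (hu n).
(* The first variation at the limit, from the approximate minimality of the
   [u n]. *)
have variation w r : W w ->
    0 <= 2 * r * (q v w - complex.Re (phi w)) + r ^+ 2 * q w w.
  move=> hw; rewrite leNgt; apply/negP => hneg; set t := (X in X < 0) in hneg.
  have k0 : 0 < 2 * `|r| * (`|M| * nr w) + 1.
    have : 0 <= 2 * `|r| * (`|M| * nr w) by rewrite !mulr_ge0 ?nr_ge0 //; lra.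
    lra.
  have e0 : 0 < - t / 2 / (2 * `|r| * (`|M| * nr w) + 1).
    by rewrite divr_gt0 //; lra.
  have [N1 hN1] := hv _ e0.
  have [N2 hN2] := geo_small r01 (ltac:(lra) : 0 < - t / 2).
  have := hN1 (maxn N1 N2) (leq_maxl _ _).
  have := hN2 (maxn N1 N2) (leq_maxr _ _).
  have [] := hu (maxn N1 N2); set n := maxn _ _ => Wn Jn hn2.
  rewrite ltr_pdivlMr // => hn1.
  have := j_le (WD Wn (WZ r%:C hw)); rewrite J_expand => h1.
  have h2 : `|q (u n) w - q v w| <= `|M| * nr (u n - v) * nr w.
    have -> : q (u n) w - q v w = q (u n - v) w.
      have -> : u n - v = u n + (-1 : R)%:C *: v by rewrite rmorphN1 scaleN1r.
      by rewrite ![q _ w]qC qDr qZr !mulN1r.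
    apply: le_trans (nr_ge_Re _) _; apply: le_trans (QM _ _) _.
    by rewrite ler_wpM2r ?nr_ge0 // ler_wpM2r ?nr_ge0 // ler_norm.
  have h3 : 2 * r * (q (u n) w - q v w) <=
      2 * `|r| * (`|M| * nr w) * nr (u n - v).
    apply: le_trans (ler_norm _) _.
    rewrite !normrM (ger0_norm (_ : 0 <= 2 :> R)) //.
    rewrite -!mulrA ler_wpM2l // ler_wpM2l // [nr w * _]mulrC mulrA //.
  have := nr_ge0 (u n - v); rewrite /t in hneg hn1 hn2 *.
  by nra.
exists v => // w hw.
have Req x : W x -> q v x = complex.Re (phi x).
  move=> hx; have qx : 0 <= q x x.
    by apply: le_trans (Qm hx); rewrite mulr_ge0 ?sqr_ge0 // ltW.
  set D := q v x - complex.Re (phi x).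
  (* The step [r = - D / (q x x + 1)] makes the quadratic in [r] negative. *)
  suff : D = 0 by move/eqP; rewrite subr_eq0 => /eqP.
  apply: contrapT => /eqP D0.
  have := variation x (- D / (q x x + 1)) hx; rewrite -/D.
  have -> : 2 * (- D / (q x x + 1)) * D + (- D / (q x x + 1)) ^+ 2 * q x x =
     - (D ^+ 2 * (q x x + 2) / (q x x + 1) ^+ 2).
    by field; apply: lt0r_neq0; lra.
  rewrite oppr_ge0 leNgt divr_gt0 //; last by rewrite exprn_gt0 //; lra.
  by rewrite mulr_gt0 ?exprn_even_gt0 //; lra.
have [i [_ ii _]] := imaginary_unit R.
(* The imaginary part is the real part at [i w]. *)
have e1 := Req w hw; have e2 := Req ('i%C *: w) (WZ _ hw).
move: e1 e2; rewrite /q QZ phiZ; case: (Q v w) (phi w) => a b [c d] /= -> h.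
by congr (_ +i* _)%C; move: h; rewrite !mul0r !mul1r !sub0r => /oppr_inj.
Qed.

End SymmetricLaxMilgram.

(** * Operators representing sesquilinear forms *)

Section BoundedForms.
Context {R : realType} {A : cstarType R} {X Y : hilbertModType A}.
Context {B : X -> Y -> A} (hB : bounded_sesquilinear B).
Implicit Types (x : X) (y : Y) (a b c : A).

Lemma sesqDr x y y' : B x (y + y') = B x y + B x y'.
Proof.
have [[_ h] _ _] := hB; have := h x 1 y y'; rewrite /= !scale1r; exact.
Qed.

Lemma sesqZr x (k : R[i]) y : B x (k *: y) = k *: B x y.
Proof.
have [[_ h] _ _] := hB; have h0 := h x 1 0 0; rewrite /= !scale1r addr0 in h0.
have z : B x 0 = 0 by apply: (addrI (B x 0)); rewrite -h0 addr0.
by have := h x k y 0; rewrite /= !addr0 z addr0.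
Qed.

Lemma sesqDl x x' y : B (x + x') y = B x y + B x' y.
Proof.
have [[h _] _ _] := hB; have := h y 1 x x'.
rewrite /= !scale1r rmorph1 scale1r; exact.
Qed.

Lemma sesqZl (k : R[i]) x y : B (k *: x) y = Num.conj k *: B x y.
Proof.
have [[h _] _ _] := hB.
have z : B 0 y = 0.
  have h0 := h y 1 0 0; rewrite /= rmorph1 !scale1r addr0 in h0.
  by apply: (addrI (B 0 y)); rewrite -h0 addr0.
by have := h y k x 0; rewrite /= !addr0 z addr0.
Qed.

Lemma sesq_bounded : exists2 M : R, 0 <= M &
  forall x y, nr (B x y) <= M * nr x * nr y.
Proof.
have [_ _ [M hM]] := hB; exists `|M| => // x y.
have : nr (B x y) <= M * nr x * nr y by rewrite -lecR !rmorphM /= -!nrE.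
move/le_trans; apply; rewrite ler_wpM2r ?nr_ge0 // ler_wpM2r ?nr_ge0 //.
exact: ler_norm.
Qed.

(** Take [a = c^*] and [b = c^* c]. *)
Lemma cmul_nondegenerate c : (forall a b, cmul (cmul a c) b = 0) -> c = 0.
Proof.
move=> h; have := h (star c) (cmul (star c) c).
rewrite -{1}[cmul (star c) c]starK starM starK => /(congr1 nr).
rewrite nr_star_cmul nr0 => /eqP; rewrite sqrf_eq0.
by rewrite nr_star_cmul sqrf_eq0 => /eqP/nr_eq0.
Qed.

(** Linearity over [A] is given for both arguments at once, and there is no unit
    for one of the coefficients: hence the detour by [cmul_nondegenerate]. *)
Lemma sesq_ractr x y b : B x (ract y b) = cmul (B x y) b.
Proof.
have [_ h _] := hB; apply/eqP; rewrite -subr_eq0; apply/eqP.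
apply: cmul_nondegenerate => a c; rewrite !calgE.
have := h x (ract y b) (star a) c; rewrite starK => <-.
by rewrite ractA h starK !cmulA subrr.
Qed.

Lemma sesq_ractl x y a : B (ract x a) y = cmul (star a) (B x y).
Proof.
have [_ h _] := hB; apply/eqP; rewrite -subr_eq0; apply/eqP.
apply: cmul_nondegenerate => b c; rewrite !calgE.
have := h (ract x a) y (star b) c; rewrite starK => <-.
by rewrite ractA h starM starK subrr.
Qed.

Lemma star_flip_sesquilinear : bounded_sesquilinear (fun y x => star (B x y)).
Proof.
split.
- split=> [x k y y'|y k x x'] /=.
    by rewrite sesqDr sesqZr starD starZ.
  by rewrite sesqDl sesqZl starD starZ conjCK.
- by move=> y x a b; have [_ -> _] := hB; rewrite !starM starK cmulA.
- have [_ _ [M hM]] := hB; exists M => y x.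
  by have := hM x y; rewrite !nrE nr_star mulrAC.
Qed.

End BoundedForms.

Section FormRepresentation.
Context {R : realType} {A : cstarType R} {H : completeNormedModType R[i]}.
Context {form : {dot H for (@Num.conj R[i])}} {rep : A -> {linear H -> H}}.
Context (form_norm : hilbert_form form).
Context (rep_morph : star_representation form rep).
Context (rep_inj : forall a b, rep a =1 rep b -> a = b).
Context (rep_compact : forall a, compact_operator (rep a)).
Implicit Types (a b c p q : A) (f : {scalar A}).

Lemma tends_slice (X : hilbertModType A) p (u : nat -> X) l :
  (forall n, ract (u n) p = u n) -> tends u l -> ract l p = l.
Proof.
move=> hu h; apply: tends_unique (tends_ract p h) _.
by apply: tends_ext h => n; rewrite hu.
Qed.

Lemma corner_star p f a : minproj p ->
  (forall a, cmul (cmul p a) p = f a *: p) ->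
  f (star a) = Num.conj (f a).
Proof.
move=> hp hf; have [[ps _] p0 _] := hp; apply: (proj_scale_inj p0).
by rewrite -hf -[in RHS]ps -starZ -hf !starM ps cmulA.
Qed.

Lemma corner_mulr p f a : minproj p ->
  (forall a, cmul (cmul p a) p = f a *: p) ->
  f (cmul a p) = f a.
Proof.
move=> hp hf; have [[_ pp] p0 _] := hp; apply: (corner_eq hp hf).
by rewrite cmulA -cmulA pp.
Qed.

Lemma corner_ip_le (X : hilbertModType A) p f (x y : X) : minproj p ->
  (forall a, cmul (cmul p a) p = f a *: p) -> nr (f (ip x y)) <= nr x * nr y.
Proof.
move=> hp hf; apply: le_trans (nr_corner_le hp hf _) _.
exact: (cauchy_schwarz form_norm rep_morph rep_inj).
Qed.

(** On the slice [X p], the scalar form [f <x, y>] makes a Hilbert space; a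
    representing vector there represents [B (x p)] on all of [Y], because [Y a]
    is inside [Y] for every [a]. *)
Lemma slice_representation (X Y : hilbertModType A) (B : X -> Y -> A) p x :
  bounded_sesquilinear B -> minproj p ->
  exists z, forall y, B (ract x p) y = ip z y.
Proof.
move=> hB hp; have [f hf] := corner_functional form_norm rep_morph rep_inj
  rep_compact hp.
have [[ps pp] p0 _] := hp; have [M M0 hM] := sesq_bounded hB.
have [|||||||||||||z zp hz] := @symmetric_lax_milgram R Y (fun y => ract y p = y)
  (fun y y' => f (ip y y')) (fun y => f (B (ract x p) y)) 1 1 (M * nr (ract x p)).
- exact: ract0l.
- by move=> u v hu hv; rewrite ractDl hu hv.
- by move=> k u hu; rewrite ractZl hu.
- exact: tends_slice.
- by move=> u v w; rewrite ipDr linearD.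
- by move=> k u v; rewrite ipZr linearZ.
- by move=> u v; rewrite -ip_star (corner_star _ hp hf).
- by move=> u v; rewrite (sesqDr hB) linearD.
- by move=> k u; rewrite (sesqZr hB) linearZ.
- exact: ltr01.
- move=> u hu; rewrite mul1r (corner_ip form_norm rep_morph rep_inj hp hf hu).
  by rewrite linearZ /= (corner_p hp hf) mulr1.
- by move=> u v; rewrite mul1r (corner_ip_le _ _ hp hf).
- by move=> u; apply: le_trans (nr_corner_le hp hf _) (hM _ _).
exists z => y; apply/eqP; rewrite -subr_eq0; apply/eqP.
pose w y := B (ract x p) y - ip z y.
have pw u : cmul p (w u) = w u.
  by rewrite /w (sesq_ractl hB) -{1 2}zp ip_ractl ps !calgE !pp.
have wr u a : w (ract u a) = cmul (w u) a.
  by rewrite /w (sesq_ractr hB) ip_ract !calgE.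
have wp u : cmul (w u) p = 0.
  rewrite -pw hf -(corner_mulr (w u) hp hf) -wr /w linearB -hz ?subrr ?scale0r //.
  by rewrite ractA pp.
rewrite -/(w y); clearbody w; have := wp (ract y (star (w y))); rewrite wr -cmulA.
have -> : cmul (star (w y)) p = star (w y) by rewrite -{2}(pw y) starM ps.
move/(congr1 nr); rewrite -{1}[w y]starK nr_star_cmul nr0 nr_star => /eqP.
by rewrite sqrf_eq0 => /eqP/nr_eq0.
Qed.

(** A vector [z] that represents [B x] has norm at most [M * nr x]; so the
    representable [x] form a closed subspace, which contains the slices. *)
Lemma form_representation (X Y : hilbertModType A) (B : X -> Y -> A) :
  bounded_sesquilinear B -> exists T : {linear X -> Y},
  [/\ forall x y, B x y = ip (T x) y, forall x a, T (ract x a) = ract (T x) a &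
      exists2 M : R, 0 <= M & forall x, nr (T x) <= M * nr x].
Proof.
move=> hB; have [M M0 hM] := sesq_bounded hB.
have bound x z : (forall y, B x y = ip z y) -> nr z <= M * nr x.
  move=> h; have := hM x z; rewrite h nr_ip expr2.
  have [->|/eqP/nr_gt0 z0] := eqVneq z 0; first by rewrite nr0 mulr_ge0 ?nr_ge0.
  by rewrite ler_pM2r.
have ex x : exists z, forall y, B x y = ip z y.
  move: x; apply: (module_density form_norm rep_morph rep_inj rep_compact).
  - exists 0 => y.
    by rewrite ip0l -(scale0r (0 : X)) (sesqZl hB) rmorph0 scale0r.
  - by move=> p x hp; apply: slice_representation.
  - move=> x x' [z hz] [z' hz']; exists (z + z') => y.
    by rewrite (sesqDl hB) hz hz' ipDl.
  - move=> u x /choice[z hz] hu.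
    have [l hl] : exists l, tends z l.
      apply: nr_complete => d d0; have M1 : 0 < M + 1 by lra.
      have [N hN] := hu (d / (M + 1) / 2) ltac:(by rewrite !divr_gt0).
      exists N => n k hn hk.
      have h : forall y, B (u n - u k) y = ip (z n - z k) y.
        move=> y; rewrite (sesqDl hB) -scaleN1r (sesqZl hB) rmorphN rmorph1.
        by rewrite scaleN1r hz hz ipDl ipNl.
      apply: le_lt_trans (bound _ _ h) _.
      have := nr_sub_trans x (u n) (u k); rewrite (nrBC x).
      have h1 := hN n hn; have h2 := hN k hk => h3.
      have : nr (u n - u k) * (M + 1) < d by rewrite -ltr_pdivlMr //; lra.
      by have := nr_ge0 (u n - u k); lra.
    exists l => y; apply: (tends_unique (u := fun n => B (u n) y)).
      apply: (tends_lip (f := fun x => B x y) (K := M * nr y) _ hu) => s t.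
      have -> : B s y - B t y = B (s - t) y.
        rewrite (sesqDl hB) -[- t]scaleN1r (sesqZl hB) rmorphN rmorph1.
        by rewrite scaleN1r.
      by rewrite mulrAC hM.
    apply: tends_ext (tends_ipl form_norm rep_morph rep_inj y hl) => n.
    by rewrite hz.
have [T hT] := choice ex.
have [|G hG] := @linear_of R X Y *:%R T.
  move=> k x x'; apply: ip_ext => y.
  by rewrite -hT (sesqDl hB) (sesqZl hB) !hT ipDl ipZl.
exists G; split=> [x y|x a|]; first by rewrite hG.
  by rewrite !hG; apply: ip_ext => y; rewrite -hT (sesq_ractl hB) hT ip_ractl.
by exists M => // x; rewrite hG; apply: bound.
Qed.

(** Apply the hypothesis to the slice where [x] attains its norm. *)
Lemma lower_bound (X Y : hilbertModType A) (T : {linear X -> Y}) (k : R) :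
  (forall x a, T (ract x a) = ract (T x) a) ->
  (forall p x, minproj p -> ract x p = x -> k * nr x <= nr (T x)) ->
  forall x, k * nr x <= nr (T x).
Proof.
move=> Tr hT x; have [->|/eqP x0] := eqVneq x 0.
  by rewrite nr0 mulr0 nr_ge0.
have [p hp <-] := norm_attained form_norm rep_morph rep_inj rep_compact x0.
have [hpp _ _] := hp; have [_ pp] := hpp.
apply: le_trans (hT p _ hp _) _; first by rewrite ractA pp.
rewrite Tr; apply: le_trans (nr_ract _ _) _.
by rewrite ler_piMr ?nr_ge0 // nr_proj_le1.
Qed.

(** At the pure state of a minimal projection [p] and for [x] in [X p], the
    inequality bounds [c k |x|] by [|f <T x, y>|], hence by [|T x|]. *)
Lemma pure_lower_bound (X Y : hilbertModType A) (T : {linear X -> Y}) (c k : R) :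
  0 < c -> (forall x a, T (ract x a) = ract (T x) a) ->
  (forall p f x, minproj p -> (forall a, cmul (cmul p a) p = f a *: p) ->
     exists y : Y, [/\ `|y| = 1, k%:C <= f (modabs y) &
       c%:C * f (modabs x) * f (modabs y) <= `|f (ip (T x) y)|]) ->
  forall x, c * k * nr x <= nr (T x).
Proof.
move=> c0 Tr hT; apply: (lower_bound Tr) => p x hp xp.
have [f hf] := corner_functional form_norm rep_morph rep_inj rep_compact hp.
have [y [y1 ky]] := hT p f x hp hf.
rewrite (corner_modabs form_norm rep_morph rep_inj hp hf xp) => h.
have {}y1 : nr y = 1 by apply: complexI; rewrite -nrE y1.
have : (c * nr x * k)%:C <= `|f (ip (T x) y)|.
  apply: le_trans h; rewrite !rmorphM /= ler_wpM2l //.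
  by rewrite -rmorphM ler0c mulr_ge0 ?nr_ge0 // ltW.
rewrite nrE lecR mulrAC => /le_trans; apply.
by have := corner_ip_le (T x) y hp hf; rewrite y1 mulr1.
Qed.

(** On a slice, [T S] is coercive when [S] is the adjoint of [T]; the range of
    [T] is closed as [T] is bounded below, and contains every slice. *)
Lemma adjoint_surjective (X Y : hilbertModType A) (T : {linear X -> Y})
    (S : {linear Y -> X}) (M N k l : R) : 0 < k -> 0 < l -> 0 <= N ->
  (forall x y, ip (T x) y = ip x (S y)) ->
  (forall x a, T (ract x a) = ract (T x) a) ->
  (forall y a, S (ract y a) = ract (S y) a) ->
  (forall x, nr (T x) <= M * nr x) -> (forall y, nr (S y) <= N * nr y) ->
  (forall x, k * nr x <= nr (T x)) -> (forall y, l * nr y <= nr (S y)) ->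
  forall y, exists x, T x = y.
Proof.
move=> k0 l0 N0 adj Tr Sr TM SM Tk Sk.
apply: (module_density form_norm rep_morph rep_inj rep_compact).
- by exists 0; rewrite linear0.
- move=> p y0 hp.
  have [f hf] := corner_functional form_norm rep_morph rep_inj rep_compact hp.
  have [[ps pp] p0 _] := hp; pose y1 := ract y0 p.
  have [|||||||||||||v vp hv] := @symmetric_lax_milgram R Y (fun y => ract y p = y)
    (fun y y' => f (ip (S y) (S y'))) (fun y => f (ip y1 y))
    (l ^+ 2) (N ^+ 2) (nr y1).
  + exact: ract0l.
  + by move=> u v hu hv; rewrite ractDl hu hv.
  + by move=> z u hu; rewrite ractZl hu.
  + exact: tends_slice.
  + by move=> u v w; rewrite linearD ipDr linearD.
  + by move=> z u v; rewrite linearZ ipZr linearZ.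
  + by move=> u v; rewrite -ip_star (corner_star _ hp hf).
  + by move=> u v; rewrite ipDr linearD.
  + by move=> z u; rewrite ipZr linearZ.
  + by rewrite exprn_gt0.
  + move=> u hu; have hSu : ract (S u) p = S u by rewrite -Sr hu.
    rewrite (corner_ip form_norm rep_morph rep_inj hp hf hSu).
    rewrite linearZ /= (corner_p hp hf) mulr1 -exprMn.
    by rewrite ler_sqr ?nnegrE ?mulr_ge0 ?nr_ge0 // ltW.
  + move=> u v; apply: le_trans (corner_ip_le _ _ hp hf) _.
    have -> : N ^+ 2 * nr u * nr v = (N * nr u) * (N * nr v) by ring.
    by apply: ler_pM; rewrite ?nr_ge0.
  + by move=> u; apply: corner_ip_le hp hf.
  exists (S v); apply/eqP; rewrite -subr_eq0; apply/eqP.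
  have wp : ract (T (S v) - y1) p = T (S v) - y1.
    by rewrite ractDl ractNl -Tr -Sr vp /y1 ractA pp.
  have := hv _ wp; rewrite -adj => /eqP; rewrite -subr_eq0 -linearB -ipNl -ipDl.
  rewrite (corner_ip form_norm rep_morph rep_inj hp hf wp) linearZ /=.
  rewrite (corner_p hp hf) mulr1 -(rmorph0 (real_complex R)).
  by rewrite (inj_eq (@complexI R)) sqrf_eq0 => /eqP/nr_eq0.
- by move=> y y' [x <-] [x' <-]; exists (x + x'); rewrite linearD.
- move=> u y /choice[x hx] hu.
  have [x0 hx0] : exists x0, tends x x0.
    apply: nr_complete => d d0.
    have [n0 hN] := hu (k * d / 2) ltac:(by rewrite divr_gt0 ?mulr_gt0).
    exists n0 => n m hn hm; rewrite -(ltr_pM2l k0); apply: le_lt_trans (Tk _) _.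
    rewrite linearB !hx; have := nr_sub_trans y (u n) (u m); rewrite (nrBC y).
    by have := hN n hn; have := hN m hm; lra.
  exists x0; apply: tends_unique hu; apply: (tends_ext hx).
  by apply: (tends_lip (K := M) _ hx0) => s t; rewrite -linearB.
Qed.

End FormRepresentation.

Theorem theorem3p1 (R : realType) (A : cstarType R) (X Y : hilbertModType A)
    (B : X -> Y -> A)
    (hA : algebra_of_compact_operators A)
    (ha : bounded_sesquilinear B)
    (hb : exists c k : R, [/\ 0 < c, 0 < k &
      forall (f : {scalar A}) (x : X), pure_state f ->
        exists y : Y, [/\ `|y| = 1, k%:C <= f (modabs y) &
          c%:C * f (modabs x) * f (modabs y) <= `|f (B x y)|]])
    (hc : exists c k : R, [/\ 0 < c, 0 < k &
      forall (f : {scalar A}) (y : Y), pure_state f ->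
        exists x : X, [/\ `|x| = 1, k%:C <= f (modabs x) &
          c%:C * f (modabs x) * f (modabs y) <= `|f (B x y)|]]) :
  exists T : {linear X -> Y},
    [/\ bounded_adjointable T,
        invertible T &
        forall (x : X) (y : Y), B x y = ip (T x) y].
Proof.
have [H [form [rep [form_norm rep_morph rep_inj rep_compact]]]] := hA.
have hflip := star_flip_sesquilinear ha.
have [T [BT Tr [M M0 TM]]] :=
  form_representation form_norm rep_morph rep_inj rep_compact ha.
have [S [BS Sr [N N0 SN]]] :=
  form_representation form_norm rep_morph rep_inj rep_compact hflip.
have adj x y : ip (T x) y = ip x (S y).
  by rewrite -BT -[LHS]starK BS ip_star.
have adj' y x : ip (S y) x = ip y (T x) by rewrite -ip_star -adj ip_star.
have [c [k [c0 k0 hx]]] := hb; have [c' [k' [c0' k0' hy]]] := hc.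
have pure := corner_pure form_norm rep_morph rep_inj rep_compact.
have low := pure_lower_bound form_norm rep_morph rep_inj rep_compact.
have Tk : forall x, c * k * nr x <= nr (T x).
  apply: (low _ _ _ _ _ c0 Tr) => p f x hp hf.
  by have [y hy0] := hx f x (pure _ _ hp hf); exists y; rewrite -BT.
have Sk : forall y, c' * k' * nr y <= nr (S y).
  apply: (low _ _ _ _ _ c0' Sr) => p f y hp hf.
  have [x [x1 kx h]] := hy f y (pure _ _ hp hf); exists x; split=> //.
  by rewrite -BS (corner_star _ hp hf) norm_conjC mulrAC.
have ck0 : 0 < c * k by rewrite mulr_gt0.
have ck0' : 0 < c' * k' by rewrite mulr_gt0.
have surj := adjoint_surjective form_norm rep_morph rep_inj rep_compact.
have [V TV] := choice (surj _ _ _ _ _ _ _ _ ck0 ck0' N0 adj Tr Sr TM SN Tk Sk).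
have [U SU] := choice (surj _ _ _ _ _ _ _ _ ck0' ck0 M0 adj' Sr Tr SN TM Sk Tk).
have Tinj x x' : T x = T x' -> x = x'.
  move=> E; apply/eqP; rewrite -subr_eq0; apply/eqP; apply: nr_eq0.
  have := Tk (x - x'); rewrite linearB E subrr nr0; have := nr_ge0 (x - x').
  nra.
have [|G hG] := @linear_of R Y X *:%R V.
  by move=> z y y'; apply: Tinj; rewrite linearP !TV.
have adjointable (P Q : hilbertModType A) (F : {linear P -> Q}) K F' :
    (forall x a, F (ract x a) = ract (F x) a) ->
    (forall x, nr (F x) <= K * nr x) ->
    (forall x y, ip (F x) y = ip x (F' y)) -> bounded_adjointable F.
  move=> Fr FK FF'; split=> //; last by exists F'.
  by exists K => x; rewrite !nrE -rmorphM lecR.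
exists T; split=> //; first exact: (adjointable _ _ _ _ _ Tr TM adj).
exists G; split=> [|x|y]; last by rewrite hG TV.
- apply: (adjointable _ _ _ (c * k)^-1 U) => [y a|y|y x].
  + by apply: Tinj; rewrite Tr !hG !TV.
  + by rewrite hG ler_pdivlMl // -{2}(TV y).
  + by rewrite -{1}(SU x) -adj hG TV.
- by apply: Tinj; rewrite hG TV.
Qed.
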